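(* Let $M^{2d+1}$ be a smooth manifold of odd dimension $2d+1$. Then $M^{2d+1}$ admits a Hamiltonian structure (a closed 2-form $\Omega$ such that $\Omega^{d}$ is nowhere vanishing) if and only if its canonical bundle admits a maximal parallel section, i.e. if and only if there exist a Riemannian metric $g$ on $M^{2d+1}$, a torsion-free linear connection $\nabla$ on $TM^{2d+1}$, and a $g$-skew-symmetric endomorphism field $\Theta\in\Gamma(\mathrm{End}(TM^{2d+1}))$ of rank $2d$ at every point such that $\nabla^{*}_{X}(\Theta Y)=\Theta(\nabla_{X}Y)$ for all vector fields $X,Y$, where $\nabla^{*}$ is the dual connection of $\nabla$ with respect to $g$.
   Context: For a Riemannian metric $g$ and a linear connection $\nabla$, the dual connection $\nabla^{*}$ is defined by $X\,g(Y,Z)=g(\nabla_XY,Z)+g(Y,\nabla^{*}_XZ)$ for all vector fields $X,Y,Z$. The quadruple $(M,g,\nabla,\nabla^{*})$ with $\nabla$ torsion-free is called a statistical manifold admitting torsion (SMAT). The connection $\widetilde\nabla$ on $\mathrm{End}(TM)$ is defined by $\nabla^{*}_{X}(\Theta Y)=(\widetilde\nabla_X\Theta)Y+\Theta\nabla_XY$; a section $\Theta$ is parallel if $\widetilde\nabla\Theta=0$. The canonical bundle $K_M$ is the bundle of skew-symmetric endomorphisms of $TM$ (with respect to $g$). On a $(2d+1)$-dimensional manifold, a parallel section of the canonical bundle is called maximal if its rank is $2d$. *)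

(* Defs.v *)
(* Built on MathComp-Analysis. *)
From HB Require Import structures.
From mathcomp Require Import all_boot all_order all_algebra all_fingroup.
From mathcomp Require Import all_classical all_reals all_analysis.
Import Order.TTheory GRing.Theory Num.Theory.
Import numFieldNormedType.Exports.

Set Implicit Arguments.
Unset Strict Implicit.
Unset Printing Implicit Defensive.

Local Open Scope classical_set_scope.
Local Open Scope ring_scope.

Section SmoothMaps.
Context {R : realType} {V W : normedModType R}.

Fixpoint iter_derive (s : seq V) (f : V -> W) : V -> W :=
  if s is v :: s' then fun x => 'D_v (iter_derive s' f) x else f.

(* f is C^oo on the open set U: all its iterated directional derivatives exist
   and are (Frechet) differentiable on U.  Values of f off U are irrelevant. *)
Definition smooth_on (U : set V) (f : V -> W) : Prop :=
  forall (s : seq V) (x : V), U x -> differentiable (iter_derive s f) x.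

End SmoothMaps.

(* A homeomorphism from an open set of M onto an open set of R^n; icoord is its
   inverse.  Both maps are total, with arbitrary values off dom and cod. *)
Record chart (R : realType) (n : nat) (M : topologicalType) := Chart {
  dom : set M;
  cod : set 'rV[R]_n;
  coord :> M -> 'rV[R]_n;
  icoord : 'rV[R]_n -> M;
  dom_open : open dom;
  cod_open : open cod;
  coord_cod : forall p, dom p -> cod (coord p);
  icoord_dom : forall x, cod x -> dom (icoord x);
  coordK : forall p, dom p -> icoord (coord p) = p;
  icoordK : forall x, cod x -> coord (icoord x) = x;
  coord_continuous : forall p, dom p -> {for p, continuous coord};
  icoord_continuous : forall x, cod x -> {for x, continuous icoord}
}.

Record smooth_manifold (R : realType) (n : nat) := SmoothManifold {
  carrier :> topologicalType;
  manifold_hausdorff : hausdorff_space carrier;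
  manifold_second_countable : @second_countable carrier;
  atlas : set (chart R n carrier);
  atlas_cover : forall p : carrier, exists2 c, atlas c & dom c p;
  atlas_smooth : forall c c', atlas c -> atlas c' ->
    smooth_on (cod c `&` (icoord c @^-1` dom c')) (c' \o icoord c)
}.

Section Calculus.
Context {R : realType} {n : nat} {M : smooth_manifold R n}.

(* The tangent space at p is identified with R^n (row vectors) through the
   coordinate basis of one chart around p, chosen once and for all.  Thus a
   vector field is a map X : M -> 'rV[R]_n, a bilinear form or an endomorphism
   on each tangent space is a map M -> 'M[R]_n, and endomorphisms act on the
   right of row vectors. *)
Definition chart_at (p : M) : chart R n M := s2val (cid2 (atlas_cover p)).

(* Components in the chart c of a tangent vector at p, and conversely. *)
Definition to_chart (c : chart R n M) (p : M) (v : 'rV[R]_n) : 'rV[R]_n :=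
  'd (c \o icoord (chart_at p)) (chart_at p p) v.

Definition of_chart (c : chart R n M) (p : M) (u : 'rV[R]_n) : 'rV[R]_n :=
  'd (chart_at p \o icoord c) (c p) u.

Definition local_rep (c : chart R n M) (X : M -> 'rV[R]_n) (x : 'rV[R]_n) :
    'rV[R]_n :=
  to_chart c (icoord c x) (X (icoord c x)).

Definition bil (B : 'M[R]_n) (u v : 'rV[R]_n) : R := (u *m B *m v^T) 0 0.

Definition bil_field (B : M -> 'M[R]_n) (X Y : M -> 'rV[R]_n) : M -> R :=
  fun p => bil (B p) (X p) (Y p).

Definition endo_field (T : M -> 'M[R]_n) (X : M -> 'rV[R]_n) : M -> 'rV[R]_n :=
  fun p => X p *m T p.

Definition smooth_fun (f : M -> R) : Prop :=
  forall c, atlas c -> smooth_on (cod c) (f \o icoord c).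

Definition smooth_vfield (X : M -> 'rV[R]_n) : Prop :=
  forall c, atlas c -> smooth_on (cod c) (local_rep c X).

Definition smooth_bil (B : M -> 'M[R]_n) : Prop :=
  forall c, atlas c -> forall u v : 'rV[R]_n,
    smooth_on (cod c) (fun x => let p := icoord c x in
      bil (B p) (of_chart c p u) (of_chart c p v)).

Definition smooth_endo (T : M -> 'M[R]_n) : Prop :=
  forall c, atlas c -> forall u : 'rV[R]_n,
    smooth_on (cod c) (fun x => let p := icoord c x in
      to_chart c p (of_chart c p u *m T p)).

(* The function X f. *)
Definition lie_fun (X : M -> 'rV[R]_n) (f : M -> R) : M -> R :=
  fun p => 'D_(X p) (f \o icoord (chart_at p)) (chart_at p p).

(* [X, Y] = DY.X - DX.Y, computed in the chosen chart around each point. *)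
Definition lie_bracket (X Y : M -> 'rV[R]_n) : M -> 'rV[R]_n :=
  fun p => let c := chart_at p in
    'D_(X p) (local_rep c Y) (c p) - 'D_(Y p) (local_rep c X) (c p).

Definition two_form (Om : M -> 'M[R]_n) : Prop :=
  smooth_bil Om /\ forall p u v, bil (Om p) u v = - bil (Om p) v u.

Definition ext_d (Om : M -> 'M[R]_n) (X Y Z : M -> 'rV[R]_n) : M -> R :=
  lie_fun X (bil_field Om Y Z) - lie_fun Y (bil_field Om X Z)
  + lie_fun Z (bil_field Om X Y)
  - bil_field Om (lie_bracket X Y) Z + bil_field Om (lie_bracket X Z) Y
  - bil_field Om (lie_bracket Y Z) X.

Definition closed_form (Om : M -> 'M[R]_n) : Prop :=
  forall X Y Z, smooth_vfield X -> smooth_vfield Y -> smooth_vfield Z ->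
    ext_d Om X Y Z = 0.

Definition riemannian_metric (g : M -> 'M[R]_n) : Prop :=
  [/\ smooth_bil g,
      forall p u v, bil (g p) u v = bil (g p) v u &
      forall p v, v != 0 -> 0 < bil (g p) v v].

(* nabla X Y stands for nabla_X Y; it is only constrained on smooth fields. *)
Definition connection
    (nabla : (M -> 'rV[R]_n) -> (M -> 'rV[R]_n) -> (M -> 'rV[R]_n)) : Prop :=
  [/\ forall X Y, smooth_vfield X -> smooth_vfield Y ->
        smooth_vfield (nabla X Y),
      forall X X' Y, smooth_vfield X -> smooth_vfield X' -> smooth_vfield Y ->
        nabla (X + X') Y = nabla X Y + nabla X' Y,
      forall f X Y, smooth_fun f -> smooth_vfield X -> smooth_vfield Y ->
        nabla (fun p => f p *: X p) Y = (fun p => f p *: nabla X Y p),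
      forall X Y Y', smooth_vfield X -> smooth_vfield Y -> smooth_vfield Y' ->
        nabla X (Y + Y') = nabla X Y + nabla X Y' &
      forall f X Y, smooth_fun f -> smooth_vfield X -> smooth_vfield Y ->
        nabla X (fun p => f p *: Y p) =
          (fun p => lie_fun X f p *: Y p + f p *: nabla X Y p)].

Definition torsion_free
    (nabla : (M -> 'rV[R]_n) -> (M -> 'rV[R]_n) -> (M -> 'rV[R]_n)) : Prop :=
  forall X Y, smooth_vfield X -> smooth_vfield Y ->
    nabla X Y - nabla Y X = lie_bracket X Y.

Definition dual_connection (g : M -> 'M[R]_n)
    (nabla nablas : (M -> 'rV[R]_n) -> (M -> 'rV[R]_n) -> (M -> 'rV[R]_n)) :
    Prop :=
  connection nablas /\
  forall X Y Z, smooth_vfield X -> smooth_vfield Y -> smooth_vfield Z ->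
    lie_fun X (bil_field g Y Z) =
      bil_field g (nabla X Y) Z + bil_field g Y (nablas X Z).

(* Statistical manifold admitting torsion, with torsion-free nabla. *)
Definition smat (g : M -> 'M[R]_n)
    (nabla nablas : (M -> 'rV[R]_n) -> (M -> 'rV[R]_n) -> (M -> 'rV[R]_n)) :
    Prop :=
  [/\ riemannian_metric g, connection nabla, torsion_free nabla &
      dual_connection g nabla nablas].

(* The connection on End(TM): (nabla~_X T) Y = nabla*_X (T Y) - T (nabla_X Y). *)
Definition endo_connection
    (nabla nablas : (M -> 'rV[R]_n) -> (M -> 'rV[R]_n) -> (M -> 'rV[R]_n))
    (X : M -> 'rV[R]_n) (T : M -> 'M[R]_n) (Y : M -> 'rV[R]_n) : M -> 'rV[R]_n :=
  nablas X (endo_field T Y) - endo_field T (nabla X Y).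

Definition parallel
    (nabla nablas : (M -> 'rV[R]_n) -> (M -> 'rV[R]_n) -> (M -> 'rV[R]_n))
    (T : M -> 'M[R]_n) : Prop :=
  forall X Y, smooth_vfield X -> smooth_vfield Y ->
    endo_connection nabla nablas X T Y = 0.

Definition canonical_section (g T : M -> 'M[R]_n) : Prop :=
  smooth_endo T /\
  forall p u v, bil (g p) (u *m T p) v = - bil (g p) u (v *m T p).

End Calculus.

(* Wedge product of alternating forms on R^n, seen as functions of a family of
   vectors, with the convention (a /\ b)(u, v) = a(u)b(v) - a(v)b(u) on covectors. *)
Definition wedge (R : realType) (n k l : nat)
    (a : ('I_k -> 'rV[R]_n) -> R) (b : ('I_l -> 'rV[R]_n) -> R) :
    ('I_(k + l) -> 'rV[R]_n) -> R :=
  fun v => (k`! * l`!)%:R^-1 * \sum_(s : 'S_(k + l)) (-1) ^+ s *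
    a (fun i => v (s (lshift l i))) * b (fun j => v (s (rshift k j))).

Fixpoint wedge_pow (R : realType) (n : nat) (a : ('I_2 -> 'rV[R]_n) -> R)
    (d : nat) : ('I_(d * 2) -> 'rV[R]_n) -> R :=
  if d is d'.+1 then wedge a (@wedge_pow R n a d') else fun=> 1.

Definition form2 (R : realType) (n : nat) (B : 'M[R]_n)
    (v : 'I_2 -> 'rV[R]_n) : R :=
  bil B (v ord0) (v ord_max).

Definition hamiltonian_structure (R : realType) (d : nat)
    (M : smooth_manifold R (2 * d).+1) (Om : M -> 'M[R]_((2 * d).+1)) : Prop :=
  [/\ two_form Om, closed_form Om &
      forall p : M, exists v, wedge_pow (form2 (Om p)) (d := d) v != 0].

Definition maximal_parallel_section (R : realType) (d : nat)
    (M : smooth_manifold R (2 * d).+1) (g : M -> 'M[R]_((2 * d).+1))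
    (nabla nablas : (M -> 'rV[R]_((2 * d).+1)) -> (M -> 'rV[R]_((2 * d).+1)) ->
      (M -> 'rV[R]_((2 * d).+1)))
    (T : M -> 'M[R]_((2 * d).+1)) : Prop :=
  [/\ canonical_section g T, parallel nabla nablas T &
      forall p : M, \rank (T p) = (2 * d)%N].

(* Main.v *)
Require Import Defs.
From HB Require Import structures.
From mathcomp Require Import all_boot all_order all_algebra all_fingroup.
From mathcomp Require Import all_classical all_reals all_analysis.
From mathcomp Require Import ring lra zify.
Import Order.TTheory GRing.Theory Num.Theory.
Import numFieldNormedType.Exports.

Set Implicit Arguments.
Unset Strict Implicit.
Unset Printing Implicit Defensive.

Local Open Scope classical_set_scope.
Local Open Scope ring_scope.

(** For a metric [g], put Om(u, v) = g(T u, v).  This is a bijection between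
    [g]-skew endomorphism fields and 2-forms which preserves the rank, and
    unfolding the definition of the dual connection turns the equation
    nabla*_X (T Y) = T (nabla_X Y) into nabla Om = 0.  Moreover Om^d is nonzero
    at a point exactly when Om has rank 2d there ([wedge_pow_rank]).  So the
    theorem says that a 2-form of rank 2d which is closed exists if and only if
    one exists that is parallel for some torsion-free connection.

    A parallel form is closed, since for a torsion-free connection d Om is the
    alternation of nabla Om ([closed_form_of_endo]).

    Conversely let Om be closed of rank 2d.  Being torsion-free and satisfying
    nabla Om = 0 are affine conditions on nabla, and for a fixed metric the dual
    of a convex combination of connections is the same combination of the
    duals.  Hence it suffices to find nabla near each point and to glue with a
    partition of unity ([partition_of_unity], [smat_glued]).  In a chart write
    nabla = D + S with S symmetric; the equation to solve is

      Om(S(X, Y), Z) - Om(S(X, Z), Y) = (D_X Om)(Y, Z).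

    For a nondegenerate form one lets Om(S(X, Y), Z) be a third of
    (D_X Om)(Y, Z) + (D_Y Om)(X, Z), which works because the cyclic sum of D Om
    vanishes.  Here a solution must also satisfy Om(S(X, Y), Z) = 0 for Z in the
    kernel line of Om.  But adding to Om(S(X, Y), Z) a totally symmetric tensor
    t(X, Y, Z) does not affect the equation, and as the kernel is only a line, t
    can be chosen to cancel the values at Z in the kernel ([contorsion],
    [christoffelP]).  For S to be smooth one needs smooth local formulas for the
    kernel and for an inverse of Om off the kernel: if e0 spans the kernel at
    one point, then Om + e0^T e0 stays invertible near it, and its inverse
    provides both ([kernel_vectorP], [bordered_solve]). *)

(** * Germs of smooth functions *)
Section Germs.
Context {R : realType} {V : normedModType R}.
Implicit Types (f g : V -> R) (x v : V).

Lemma near_eq_differentiable (W : normedModType R) (f g : V -> W) x :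
  (\forall y \near x, f y = g y) -> differentiable f x -> differentiable g x.
Proof.
move=> fg /diff_locallyP[df0 fE].
have gE : g \o shift x = cst (g x) + 'd f x +o_ 0 id.
  apply/eqaddoP => e e0.
  have /eqaddoP/(_ e e0) fE' := fE.
  have fg0 : \forall y \near (0 : V), f (y + x) = g (y + x).
    by move: fg; rewrite (near_shift 0); apply: filterS => y /=; rewrite subr0.
  apply: filterS2 fE' fg0 => y + fgy.
  by rewrite !fctE /= fgy (nbhs_singleton fg).
have dgf := diff_unique df0 gE.
by apply/diff_locallyP; rewrite dgf.
Qed.

(** Smoothness as a property of the germ at [x]: neighbourhoods may shrink with
    the order [k], so no open set has to be carried along. *)
Fixpoint Ck_at k f x : Prop :=
  (\forall y \near x, differentiable f y) /\
  if k is k'.+1 then forall v, Ck_at k' ('D_v f) x else True.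

Definition smooth_at f x := forall k, Ck_at k f x.

Lemma Ck_at_near_differentiable k f x : Ck_at k f x ->
  \forall y \near x, differentiable f y.
Proof. by case: k => [|k] []. Qed.

Lemma Ck_at_congr k f g x :
  (\forall y \near x, f y = g y) -> Ck_at k f x -> Ck_at k g x.
Proof.
elim: k f g => [|k IH] f g fg /= [df H].
  split=> //; move: (near_join fg); apply: filterS2 df => y fy.
  by move=> /near_eq_differentiable; apply.
split.
  move: (near_join fg); apply: filterS2 df => y fy.
  by move=> /near_eq_differentiable; apply.
move=> v; apply: IH (H v); move: (near_join fg); apply: filterS => y.
exact: near_eq_derive.
Qed.

Lemma Ck_atW k f x : Ck_at k.+1 f x -> Ck_at k f x.
Proof.
elim: k f => [|k IH] f [df H]; split=> //= v.
by apply: IH; exact: H.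
Qed.

Lemma Ck_at_cst k (a : R) x : Ck_at k (cst a) x.
Proof.
elim: k a => [|k IH] a /=.
  by split=> //; apply: filterE => y; exact: differentiable_cst.
split; first by apply: filterE => y; exact: differentiable_cst.
by move=> v; apply: Ck_at_congr (IH 0); apply: filterE => y; rewrite derive_cst.
Qed.

Lemma Ck_atD k f g x : Ck_at k f x -> Ck_at k g x -> Ck_at k (f + g) x.
Proof.
elim: k f g => [|k IH] f g [df Hf] [dg Hg]; split.
- by apply: filterS2 df dg => y; exact: differentiableD.
- by [].
- by apply: filterS2 df dg => y; exact: differentiableD.
- move=> v; apply: Ck_at_congr (IH _ _ (Hf v) (Hg v)).
  by apply: filterS2 df dg => y fy gy; rewrite deriveD//; exact: diff_derivable.
Qed.

Lemma Ck_atM k f g x : Ck_at k f x -> Ck_at k g x -> Ck_at k (f * g) x.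
Proof.
elim: k f g => [|k IH] f g Hf Hg.
  by split=> //; apply: filterS2 Hf.1 Hg.1 => y; exact: differentiableM.
have [df Hf'] := Hf; have [dg Hg'] := Hg; split.
  by apply: filterS2 df dg => y; exact: differentiableM.
move=> v.
have := Ck_atD (IH _ _ (Ck_atW Hf) (Hg' v)) (IH _ _ (Ck_atW Hg) (Hf' v)).
apply: Ck_at_congr; apply: filterS2 df dg => y fy gy.
by rewrite deriveM//; exact: diff_derivable.
Qed.

Lemma Ck_atV k f x : f x != 0 -> Ck_at k f x -> Ck_at k (fun y => (f y)^-1) x.
Proof.
move=> fx0; elim: k => [|k IH] Hf.
  split=> //; have [df _] := Hf.
  have cf := differentiable_continuous (nbhs_singleton df).
  have f0 : \forall y \near x, f y != 0.
    by apply: (cvgr_neq0 (f x)).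
  by apply: filterS2 df f0 => y fy y0; exact: differentiableV.
have [df Hf'] := Hf.
have cf := differentiable_continuous (nbhs_singleton df).
have f0 : \forall y \near x, f y != 0 by apply: (cvgr_neq0 (f x)).
split; first by apply: filterS2 df f0 => y fy y0; exact: differentiableV.
move=> v; have Hi := IH (Ck_atW Hf).
have := Ck_atM (Ck_at_cst k (-1) x) (Ck_atM (Hf' v) (Ck_atM Hi Hi)).
apply: Ck_at_congr; apply: filterS2 df f0 => y fy y0.
rewrite deriveV//; last exact: diff_derivable.
by rewrite !fctE /= mulN1r -expr2 exprVn scaleNr mulrC.
Qed.

Lemma smooth_at_congr f g x :
  (\forall y \near x, f y = g y) -> smooth_at f x -> smooth_at g x.
Proof. by move=> fg H k; exact: Ck_at_congr (H k). Qed.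

Lemma smooth_at_cst (a : R) x : smooth_at (fun=> a) x.
Proof. by move=> k; exact: Ck_at_cst. Qed.

Lemma smooth_atD f g x :
  smooth_at f x -> smooth_at g x -> smooth_at (fun y => f y + g y) x.
Proof. by move=> Hf Hg k; exact: Ck_atD. Qed.

Lemma smooth_atM f g x :
  smooth_at f x -> smooth_at g x -> smooth_at (fun y => f y * g y) x.
Proof. by move=> Hf Hg k; exact: Ck_atM. Qed.

Lemma smooth_atV f x : f x != 0 -> smooth_at f x ->
  smooth_at (fun y => (f y)^-1) x.
Proof. by move=> fx0 Hf k; exact: Ck_atV. Qed.

Lemma smooth_at_derive f x v : smooth_at f x -> smooth_at ('D_v f) x.
Proof. by move=> Hf k; have [_] := Hf k.+1; apply. Qed.

Lemma smooth_at_near_differentiable f x :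
  smooth_at f x -> \forall y \near x, differentiable f y.
Proof. by move=> /(_ 0); exact: Ck_at_near_differentiable. Qed.

Lemma smooth_at_differentiable f x : smooth_at f x -> differentiable f x.
Proof. by move=> /smooth_at_near_differentiable/nbhs_singleton. Qed.

Lemma Ck_at_derive_cst k f x : (forall y, differentiable f y) ->
  (forall v, exists a, forall y, 'D_v f y = a) -> Ck_at k f x.
Proof.
move=> df Df; case: k => [|k] /=; first by split=> //; exact: filterE.
split; first exact: filterE.
move=> v; have [a Ha] := Df v; apply: Ck_at_congr (Ck_at_cst k a x).
by apply: filterE => y; rewrite Ha.
Qed.

End Germs.

(** * Vector-valued functions and composition *)
Section VectorValued.
Context {R : realType} {V : normedModType R}.
Implicit Types (x v : V).

Lemma derive_coord m (F : V -> 'rV[R]_m) x v : derivable F x v ->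
  forall j, 'D_v F x 0 j = 'D_v (fun y => F y 0 j) x.
Proof. by move=> dF j; rewrite (derive_mx dF) mxE. Qed.

Lemma differentiable_coord_fun m (F : V -> 'rV[R]_m) x j :
  differentiable F x -> differentiable (fun y => F y 0 j) x.
Proof.
move=> dF; apply: (@differentiable_comp _ _ _ _ F (fun A :
  'rV[R]_m => A 0 j)) => //.
exact: differentiable_coord.
Qed.

Lemma differentiable_rV m (F : V -> 'rV[R]_m) x :
  (forall j, differentiable (fun y => F y 0 j) x) -> differentiable F x.
Proof.
move=> dF; have -> : F = \sum_(j < m) (fun y => F y 0 j *: delta_mx 0 j).
  by apply/funext => y; rewrite fct_sumE [LHS]row_sum_delta.
by apply: differentiable_sum => j; apply: differentiableZl.
Qed.

Lemma iter_derive_rcons (W : normedModType R) s v (f : V -> W) :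
  iter_derive (rcons s v) f = iter_derive s ('D_v f).
Proof. by elim: s => [//|w s /= ->]. Qed.

Lemma smooth_on_derive (W : normedModType R) U (f : V -> W) v :
  smooth_on U f -> smooth_on U ('D_v f).
Proof. by move=> Hf s x Ux; rewrite -iter_derive_rcons; exact: Hf. Qed.

Lemma smooth_on_near_diff (W : normedModType R) U (f : V -> W) x :
  smooth_on U f -> nbhs x U -> \forall y \near x, differentiable f y.
Proof. by move=> Hf; apply: filterS => y /(Hf [::]). Qed.

Lemma smooth_on_smooth_at U (f : V -> R) (x : V) : smooth_on U f -> nbhs x U ->
  smooth_at f x.
Proof.
move=> Hf Ux k; elim: k f Hf => [|k IH] f Hf; split=> //.
- exact: smooth_on_near_diff Hf Ux.
- exact: smooth_on_near_diff Hf Ux.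
- by move=> v; apply: IH; exact: smooth_on_derive.
Qed.

Lemma smooth_on_smooth_at_rV m U (F : V -> 'rV[R]_m) x j :
  smooth_on U F -> nbhs x U -> smooth_at (fun y => F y 0 j) x.
Proof.
move=> HF Ux k; elim: k F HF => [|k IH] F HF.
  split=> //; apply: filterS (smooth_on_near_diff HF Ux) => y.
  exact: differentiable_coord_fun.
split.
  apply: filterS (smooth_on_near_diff HF Ux) => y.
  exact: differentiable_coord_fun.
move=> v; apply: Ck_at_congr (IH _ (smooth_on_derive v HF)).
apply: filterS (smooth_on_near_diff HF Ux) => y dF.
by rewrite derive_coord//; exact: diff_derivable.
Qed.

Lemma smooth_at_smooth_on U (f : V -> R) :
  (forall x, U x -> smooth_at f x) -> smooth_on U f.
Proof.
move=> Hf s x Ux; elim/last_ind: s f Hf => [|s v IH] f Hf.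
  exact: smooth_at_differentiable (Hf _ Ux).
rewrite iter_derive_rcons; apply: IH => y Uy.
exact: smooth_at_derive (Hf _ Uy).
Qed.

Lemma smooth_at_smooth_on_rV m U (F : V -> 'rV[R]_m) :
  (forall x j, U x -> smooth_at (fun y => F y 0 j) x) -> smooth_on U F.
Proof.
move=> HF s x Ux; elim/last_ind: s F HF => [|s v IH] F HF.
  by apply: differentiable_rV => j; exact: smooth_at_differentiable (HF _ _ Ux).
rewrite iter_derive_rcons; apply: IH => y j Uy.
apply: smooth_at_congr (smooth_at_derive v (HF y j Uy)).
have : \forall z \near y, forall j, differentiable (fun y => F y 0 j) z.
  by apply: filter_forall => i; exact: smooth_at_near_differentiable (HF _ _
    Uy).
apply: filterS => z /differentiable_rV dF.
by rewrite derive_coord//; exact: diff_derivable.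
Qed.

Lemma smooth_at_sum I (r : seq I) (P : pred I) (f : I -> V -> R) x :
  (forall i, P i -> smooth_at (f i) x) ->
  smooth_at (fun y => \sum_(i <- r | P i) f i y) x.
Proof.
move=> Hf; elim: r => [|i r IH].
  by apply: smooth_at_congr (smooth_at_cst 0 x); apply: filterE => y;
    rewrite big_nil.
case Pi : (P i).
  apply: smooth_at_congr (smooth_atD (Hf i Pi) IH).
  by apply: filterE => y; rewrite big_cons Pi.
by apply: smooth_at_congr IH; apply: filterE => y; rewrite big_cons Pi.
Qed.

Lemma smooth_at_prod I (r : seq I) (P : pred I) (f : I -> V -> R) x :
  (forall i, P i -> smooth_at (f i) x) ->
  smooth_at (fun y => \prod_(i <- r | P i) f i y) x.
Proof.
move=> Hf; elim: r => [|i r IH].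
  by apply: smooth_at_congr (smooth_at_cst 1 x); apply: filterE => y;
    rewrite big_nil.
case Pi : (P i).
  apply: smooth_at_congr (smooth_atM (Hf i Pi) IH).
  by apply: filterE => y; rewrite big_cons Pi.
by apply: smooth_at_congr IH; apply: filterE => y; rewrite big_cons Pi.
Qed.

Lemma derive_comp_rV m (g : 'rV[R]_m -> R) (F : V -> 'rV[R]_m) x v :
  differentiable F x -> differentiable g (F x) ->
  'D_v (g \o F) x = \sum_j 'D_(delta_mx 0 j) g (F x) * 'D_v (fun y => F y 0 j)
    x.
Proof.
move=> dF dg; rewrite deriveE; last exact: differentiable_comp.
rewrite diff_comp//; transitivity ('d g (F x) ('D_v F x)).
  by rewrite [in RHS]deriveE.
rewrite {1}(row_sum_delta ('D_v F x)) linear_sum; apply: eq_bigr => j _.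
rewrite linearZ /= -deriveE// mulrC; congr (_ * _).
by rewrite derive_coord//; exact: diff_derivable.
Qed.

Lemma smooth_at_comp_rV m (g : 'rV[R]_m -> R) (F : V -> 'rV[R]_m) x :
  (forall j, smooth_at (fun y => F y 0 j) x) -> smooth_at g (F x) ->
  smooth_at (g \o F) x.
Proof.
move=> HF Hg k.
have dF : \forall y \near x, differentiable F y.
  have : \forall y \near x, forall j, differentiable (fun y => F y 0 j) y.
    by apply: filter_forall => i; exact: smooth_at_near_differentiable (HF _).
  by apply: filterS => y /differentiable_rV.
have cF : {for x, continuous F}.
  exact: differentiable_continuous (nbhs_singleton dF).
elim: k g Hg => [|k IH] g Hg.
  split=> //; have := cF _ (smooth_at_near_differentiable Hg).
  by apply: filterS2 dF => y Fy gy; exact: differentiable_comp.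
have dg := cF _ (smooth_at_near_differentiable Hg).
split; first by apply: filterS2 dF dg => y Fy gy; exact: differentiable_comp.
move=> v.
have ck_sum (f : 'I_m -> V -> R) : (forall j, Ck_at k (f j) x) ->
    Ck_at k (fun y => \sum_j f j y) x.
  move=> Hf; elim: (index_enum _) => [|i r IHr].
    by apply: Ck_at_congr (Ck_at_cst k 0 x); apply: filterE => y;
      rewrite big_nil.
  by apply: Ck_at_congr (Ck_atD (Hf i) IHr); apply: filterE => y;
    rewrite big_cons.
have := ck_sum (fun j y => ('D_(delta_mx 0 j) g \o F) y *
  'D_v (fun y => F y 0 j) y) (fun j => Ck_atM (IH _ (smooth_at_derive _ Hg))
  (smooth_at_derive v (HF j) k)).
apply: Ck_at_congr; apply: filterS2 dF dg => y Fy gy.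
by rewrite derive_comp_rV.
Qed.

End VectorValued.

Lemma smooth_at_coord (R : realType) m (x : 'rV[R]_m) j : smooth_at (fun y :
  'rV[R]_m => y 0 j) x.
Proof.
move=> k; apply: Ck_at_derive_cst => [y|v]; first exact: differentiable_coord.
exists (v 0 j) => y.
have := derive_coord (@derivable_id _ 'rV[R]_m y v) j.
by rewrite derive_id => /esym.
Qed.

(** * Symmetry of second derivatives *)
Section Schwarz.
Context {R : realType} {V : normedModType R}.
Implicit Types (f : V -> R) (x u v : V).

Lemma is_derive_line f x u (s : R) : differentiable f (x + s *: u) ->
  is_derive s 1 (fun s => f (x + s *: u)) ('D_u f (x + s *: u)).
Proof.
move=> df.
pose L : R -> V := cst x + ( *:%R^~ u).
have dl : is_diff s L (0 + ( *:%R^~ u)).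
  exact: (@is_diffD _ _ _ _ _ _ _ _ (is_diff_cst _ _) (is_diff_scalel _ _)).
have dc : differentiable (f \o L) s.
  by apply: differentiable_comp => //; exact: ex_diff.
apply: DeriveDef; first exact: (diff_derivable (f := f \o L)).
have dL : differentiable L s by exact: ex_diff.
rewrite (@deriveE _ _ _ (f \o L))// diff_comp//.
rewrite diff_val /= [in RHS]deriveE//.
by rewrite fctE /= add0r scale1r.
Qed.

Lemma double_MVT f x u v (h : R) : 0 < h ->
  (forall s t, s \in `[0, h] -> t \in `[0, h] ->
     differentiable f (x + s *: u + t *: v) /\
     differentiable ('D_u f) (x + s *: u + t *: v)) ->
  exists s t, [/\ s \in `[0, h], t \in `[0, h] &
    f (x + h *: u + h *: v) - f (x + h *: u) - f (x + h *: v) + f x =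
    'D_v ('D_u f) (x + s *: u + t *: v) * h * h].
Proof.
move=> h0 Hd.
have I0 : (0 : R) \in `[0, h] by rewrite in_itv /= lexx ltW.
have Ih : h \in `[0, h] by rewrite in_itv /= lexx ltW.
pose F s := f (x + h *: v + s *: u) - f (x + s *: u).
pose dF s := 'D_u f (x + h *: v + s *: u) - 'D_u f (x + s *: u).
have HF s : s \in `[0, h] -> is_derive s 1 F (dF s).
  move=> sI; apply: is_deriveB.
    by apply: is_derive_line; rewrite addrAC; have [] := Hd s h sI Ih.
  apply: is_derive_line.
  by have [] := Hd s 0 sI I0; rewrite scale0r addr0.
have sub t : t \in `]0, h[ -> t \in `[0, h].
  by rewrite !in_itv /= => /andP[/ltW -> /ltW ->].
have cF : {within `[0, h], continuous F}.
  by apply: derivable_within_continuous => t tI; have [] := HF t tI.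
have HF' t : t \in `]0, h[ -> is_derive t 1 F (dF t).
  by move=> /sub tI; exact: HF.
have [s sI Es] := MVT h0 HF' cF.
pose G t := 'D_u f (x + s *: u + t *: v).
have HG t : t \in `[0, h] ->
    is_derive t 1 G ('D_v ('D_u f) (x + s *: u + t *: v)).
  by move=> tI; apply: is_derive_line; have [] := Hd s t (sub _ sI) tI.
have cG : {within `[0, h], continuous G}.
  by apply: derivable_within_continuous => t tI; have [] := HG t tI.
have HG' t : t \in `]0, h[ ->
    is_derive t 1 G ('D_v ('D_u f) (x + s *: u + t *: v)).
  by move=> /sub tI; exact: HG.
have [t tI Et] := MVT h0 HG' cG.
exists s, t; split; [exact: sub|exact: sub|].
have -> : 'D_v ('D_u f) (x + s *: u + t *: v) * h = dF s.
  by rewrite -[X in _ * X]subr0 -Et /G scale0r addr0 /dF (addrAC x).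
rewrite -[X in _ * X]subr0 -Es /F scale0r !addr0 (addrAC x (h *: v)).
by ring.
Qed.

Lemma near_parallelogram x u v (P : V -> Prop) : (\forall y \near x, P y) ->
  exists2 h : R, 0 < h & forall s t, s \in `[0, h] -> t \in `[0, h] ->
    P (x + s *: u + t *: v).
Proof.
move=> /nbhs_ballP[r /= r0 HP].
have k0 : 0 < 1 + `|u| + `|v|.
  by rewrite -addrA ltr_pwDl// addr_ge0.
exists (r / (1 + `|u| + `|v|) / 2).
  by rewrite !divr_gt0.
move=> s t; rewrite !in_itv /= => /andP[s0 sh] /andP[t0 th]; apply: HP.
rewrite -ball_normE /ball_ /= -addrA opprD addrA subrr sub0r normrN.
set h := r / _ / 2 in sh th.
have : h * (1 + `|u| + `|v|) < r.
  by rewrite /h mulrAC divfK ?gt_eqF// ltr_pdivrMr// ltr_pMr// ltr1n.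
apply: le_lt_trans; rewrite (le_trans (ler_normD _ _))// !normrZ.
rewrite !ger0_norm// mulrDr mulrDr mulr1 -addrA ler_wpDl//.
  by rewrite (le_trans s0).
by apply: lerD; apply: ler_wpM2r.
Qed.

(** By the mean value theorem applied twice, the second difference of [f] over
    a parallelogram with sides [h *: u] and [h *: v] is [h * h] times a value of
    either mixed derivative inside the parallelogram; let [h] tend to 0. *)
Lemma derive_comm f x u v : smooth_at f x ->
  'D_u ('D_v f) x = 'D_v ('D_u f) x.
Proof.
move=> Hf; apply/eqP; rewrite -subr_eq0 -normr_eq0.
set a := 'D_u _ x; set b := 'D_v _ x.
rewrite eq_le normr_ge0 andbT; apply/ler_addgt0Pl => e e0; rewrite addr0.
have ca := differentiable_continuous
  (smooth_at_differentiable (smooth_at_derive u (smooth_at_derive v Hf))).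
have cb := differentiable_continuous
  (smooth_at_differentiable (smooth_at_derive v (smooth_at_derive u Hf))).
have e20 : 0 < e / 2 by rewrite divr_gt0.
have na : \forall y \near x, `|a - 'D_u ('D_v f) y| < e / 2.
  by move/cvgrPdist_lt : ca; apply.
have nb : \forall y \near x, `|b - 'D_v ('D_u f) y| < e / 2.
  by move/cvgrPdist_lt : cb; apply.
have nf := smooth_at_near_differentiable Hf.
have nu := smooth_at_near_differentiable (smooth_at_derive u Hf).
have nv := smooth_at_near_differentiable (smooth_at_derive v Hf).
have [h h0 Hh] := near_parallelogram u v
  (filterI nf (filterI nu (filterI nv (filterI na nb)))).
have [s [t [sI tI E]]] := @double_MVT f x u v h h0
  (fun s t si ti => conj (Hh s t si ti).1 (Hh s t si ti).2.1).
have Hh' s' t' : s' \in `[0, h] -> t' \in `[0, h] ->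
    differentiable f (x + s' *: v + t' *: u) /\
    differentiable ('D_v f) (x + s' *: v + t' *: u).
  by move=> si ti; rewrite addrAC; have [? [_ [? _]]] := Hh t' s' ti si.
have [s' [t' [sI' tI' E']]] := double_MVT h0 Hh'.
have [_ [_ [_ [_ Hb]]]] := Hh _ _ sI tI.
have [_ [_ [_ [Ha _]]]] := Hh _ _ tI' sI'.
rewrite addrAC in Ha.
have aux (P Q D D' : R) : D = P * h * h -> D' = Q * h * h -> D = D' -> Q = P.
  by move=> -> -> /(mulIf (lt0r_neq0 h0))/(mulIf (lt0r_neq0 h0)).
have EE := aux _ _ _ _ E E'; move: Ha Hb; rewrite EE; last first.
  by rewrite (addrAC x (h *: v)); ring.
clearbody a b; move: ('D_v _ _) => c Ha Hb.
have -> : a - b = (a - c) - (b - c) by ring.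
have H : `|a - c| + `|b - c| <= e.
  by rewrite (splitr e); apply: lerD; apply: ltW.
exact: le_trans (ler_normB _ _) H.
Qed.

End Schwarz.

(** * Bump functions on Euclidean space *)
Section Bump.
Context {R : realType}.

(** The powers of [x^-1] are there to make the span of these functions stable
    under differentiation, whence all of them are smooth at 0. *)
Definition flat (m : nat) (x : R) : R :=
  if 0 < x then x^-1 ^+ m * expR (- x^-1) else 0.

Lemma flat_ge0 m x : 0 <= flat m x.
Proof.
rewrite /flat; case: ifP => // x0.
by rewrite mulr_ge0 ?expR_ge0// exprn_ge0// invr_ge0 ltW.
Qed.

Lemma flat0_gt0 x : 0 < x -> 0 < flat 0 x.
Proof. by move=> x0; rewrite /flat x0 expr0 mul1r expR_gt0. Qed.

Lemma flat_le0 m x : x <= 0 -> flat m x = 0.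
Proof. by move=> x0; rewrite /flat ltNge x0. Qed.

(** The exponential beats every power; one factor [x] is left over to make the
    difference quotient at 0 converge. *)
Lemma flat_bound m x : 0 < x -> flat m x <= (m.+1)`!%:R * x.
Proof.
move=> x0; rewrite /flat x0 expRN.
have xi0 : 0 < x^-1 by rewrite invr_gt0.
rewrite ler_pdivrMr ?expR_gt0// mulrAC -ler_pdivrMr// -exprSr mulrC.
rewrite -ler_pdivrMr ?ltr0n ?fact_gt0//.
by have := expR_ge1Dxn m (ltW xi0); apply: le_trans; rewrite ler_wpDl.
Qed.

Lemma is_derive_flat m (x : R) :
  is_derive x 1 (flat m) (flat m.+2 x - m%:R * flat m.+1 x).
Proof.
have [x0|x0|->] := ltgtP x 0.
- rewrite !flat_le0 ?ltW// mulr0 subr0.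
  apply: (@near_eq_is_derive _ _ _ (cst 0)).
  by near=> y; rewrite flat_le0// ltW//; near: y; exact: lt_nbhsl.
- apply: (@near_eq_is_derive _ _ _
    ((fun y => y^-1) ^+ m * (expR \o (fun y => - y^-1)))).
    near=> y; rewrite /flat ifT; last by near: y; exact: lt_nbhsr.
    by rewrite !fctE.
  have xn0 : x != 0 by rewrite gt_eqF.
  have dV : is_derive x 1 (fun y : R => y^-1) (- x ^- 2).
    have di : derivable (id : R -> R) x 1 by exact: derivable_id.
    apply: DeriveDef; first exact: (derivableV xn0 di).
    by rewrite (deriveV xn0 di) derive_id [LHS]mulr1.
  have dN : is_derive x 1 (fun y : R => - y^-1) (x ^- 2).
    by apply: is_derive_eq; rewrite opprK.
  have dE : is_derive x 1 (expR \o (fun y => - y^-1)) (x ^- 2 * expR (- x^-1)).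
    by apply: is_derive_eq; rewrite mulrC.
  apply: is_derive_eq.
  rewrite /flat x0 !fctE /=.
  rewrite -exprVn; set y := x^-1; set E := expR _.
  rewrite /GRing.scale /= -mulr_natr.
  case: m => [|m]; first by rewrite !expr0; ring.
  by rewrite -pred_Sn !exprS; ring.
- rewrite !flat_le0// mulr0 subr0.
  have H : (fun h => h^-1 *: (flat m (h *: 1 + 0) - flat m 0)) @ 0^' --> (0 :
    R).
    apply/cvgrPdist_lt => e e0; rewrite near_withinE.
    exists (e / m.+2`!%:R).
      by rewrite /= divr_gt0// ltr0n fact_gt0.
    move=> h /=; rewrite sub0r normrN => he hn0.
    rewrite (flat_le0 _ (lexx 0)) subr0 addr0 sub0r normrN.
    rewrite [h *: 1]mulr1.
    have [hp|hm] := ltP 0 h; last by rewrite flat_le0// scaler0 normr0.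
    rewrite ger0_norm; last by rewrite mulr_ge0// ?flat_ge0// invr_ge0 ltW.
    have -> : h^-1 *: flat m h = flat m.+1 h.
      by rewrite /flat hp exprS -mulrA.
    apply: le_lt_trans (flat_bound _ hp) _.
    rewrite mulrC -ltr_pdivlMr ?ltr0n ?fact_gt0//.
    by move: he; rewrite gtr0_norm.
  apply: DeriveDef; first by apply/cvg_ex; exists 0.
  exact/cvg_lim.
Unshelve. all: by end_near. Qed.

Lemma Ck_at_flat k m (x : R) : Ck_at k (flat m) x.
Proof.
have df n (y : R) : differentiable (flat n) y.
  by apply/derivable1_diffP; have [] := is_derive_flat n y.
elim: k m => [|k IH] m; first by split=> //; exact: filterE.
split; first exact: filterE.
move=> v.
have := Ck_atM (Ck_at_cst k v x) (Ck_atD (IH m.+2) (Ck_atM (Ck_at_cst k (-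
  m%:R) x) (IH m.+1))).
apply: Ck_at_congr; apply: filterE => y; rewrite !fctE.
rewrite [RHS]deriveE// -[X in _ = 'd _ _ X]mulr1 -/(v *: 1) linearZ /=.
rewrite -deriveE//; have [_ ->] := is_derive_flat m y.
by rewrite mulNr.
Qed.

Lemma smooth_at_flat m (x : R) : smooth_at (flat m) x.
Proof. by move=> k; exact: Ck_at_flat. Qed.

Lemma derive_comp (V : normedModType R) (g : R -> R) (f : V -> R) x v :
  differentiable f x -> differentiable g (f x) ->
  'D_v (g \o f) x = 'D_1 g (f x) * 'D_v f x.
Proof.
move=> df dg; rewrite deriveE; last exact: differentiable_comp.
rewrite diff_comp//; transitivity ('d g (f x) ('D_v f x *: 1)).
  by rewrite [X in 'd g (f x) X]mulr1 [in RHS]deriveE.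
by rewrite linearZ /= -deriveE// mulrC.
Qed.

Lemma smooth_at_comp (V : normedModType R) (g : R -> R) (f : V -> R) x :
  smooth_at f x -> smooth_at g (f x) -> smooth_at (g \o f) x.
Proof.
move=> Hf Hg k.
have df := smooth_at_near_differentiable Hf.
have cf := differentiable_continuous (nbhs_singleton df).
elim: k g Hg => [|k IH] g Hg.
  split=> //; have := cf _ (smooth_at_near_differentiable Hg).
  by apply: filterS2 df => y Fy gy; exact: differentiable_comp.
have dg := cf _ (smooth_at_near_differentiable Hg).
split; first by apply: filterS2 df dg => y Fy gy; exact: differentiable_comp.
move=> v.
have := Ck_atM (IH _ (smooth_at_derive (1 : R) Hg)) (smooth_at_derive v Hf k).
apply: Ck_at_congr; apply: filterS2 df dg => y Fy gy.
by rewrite derive_comp.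
Qed.

(** A smooth transition from 0 on the negative axis to 1 beyond 1. *)
Definition step (x : R) : R := flat 0 x / (flat 0 x + flat 0 (1 - x)).

Lemma step_den_gt0 x : 0 < flat 0 x + flat 0 (1 - x).
Proof.
have [x0|x0] := ltP 0 x; first by rewrite ltr_pwDl ?flat0_gt0// flat_ge0.
by rewrite ltr_wpDl ?flat_ge0// flat0_gt0// subr_gt0 (le_lt_trans x0).
Qed.

Lemma step_ge0 x : 0 <= step x.
Proof. by rewrite divr_ge0 ?flat_ge0// ltW// step_den_gt0. Qed.

Lemma step_le1 x : step x <= 1.
Proof. by rewrite ler_pdivrMr ?step_den_gt0// mul1r lerDl flat_ge0. Qed.

Lemma step_eq0 x : x <= 0 -> step x = 0.
Proof. by move=> x0; rewrite /step flat_le0// mul0r. Qed.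

Lemma step_eq1 x : 1 <= x -> step x = 1.
Proof.
move=> x1; rewrite /step (@flat_le0 _ (1 - x)) ?subr_le0// addr0 divff//.
by rewrite gt_eqF// flat0_gt0// (lt_le_trans _ x1).
Qed.

Lemma smooth_at_affine (a b x : R) : smooth_at (fun y : R => a * y + b) x.
Proof.
apply: smooth_atD (smooth_at_cst _ _); apply: smooth_atM (smooth_at_cst _ _) _.
move=> k; apply: Ck_at_derive_cst => [y|v]; first exact: ex_diff.
by exists v => y; exact: derive_id.
Qed.

Lemma smooth_at_step (x : R) : smooth_at step x.
Proof.
apply: smooth_atM (smooth_at_flat _ _) _; apply: smooth_atV.
  by rewrite gt_eqF// step_den_gt0.
apply: smooth_atD (smooth_at_flat _ _) _.
apply: smooth_at_congr (smooth_at_comp (smooth_at_affine (-1) 1 x)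
  (smooth_at_flat 0 _)).
by apply: filterE => y /=; rewrite mulN1r addrC.
Qed.

(** A product over the coordinates, because the norm on row vectors is the
    maximum norm. *)
Lemma bump_rV m (x0 : 'rV[R]_m) (r : R) : 0 < r ->
  exists rho : 'rV[R]_m -> R, [/\ forall x, smooth_at rho x,
    forall x, 0 <= rho x <= 1, \forall x \near x0, rho x = 1 &
    forall x, r < `|x - x0| -> rho x = 0].
Proof.
move=> r0.
(* [s j x] has modulus at most 1 for [x] within [r / 2] of [x0], and exceeds 2
   in modulus for some [j] as soon as [x] is farther than [r]. *)
pose s (j : 'I_m) (x : 'rV[R]_m) := (2 / r) * (x 0 j - x0 0 j).
pose rho x := \prod_(j < m) (step (2 - s j x) * step (2 + s j x)).
have ss j x : smooth_at (s j) x.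
  apply: smooth_atM (smooth_at_cst _ _) _;
    apply: smooth_atD (smooth_at_coord _ _) _.
  exact: smooth_at_cst.
exists rho; split.
- move=> x; apply: smooth_at_prod => j _; apply: smooth_atM.
    apply: smooth_at_comp (smooth_at_step _).
    apply: smooth_atD (smooth_at_cst _ _) _.
    apply: smooth_at_congr (smooth_atM (smooth_at_cst (-1) x) (ss j x)).
    by apply: filterE => y; rewrite mulN1r.
  apply: smooth_at_comp (smooth_at_step _).
  exact: smooth_atD (smooth_at_cst _ _) (ss j x).
- move=> x; apply: (big_ind (fun y => 0 <= y <= 1)) => [|y z|j _].
  + by rewrite ler01 lexx.
  + move=> /andP[y0 y1] /andP[z0 z1].
    by rewrite mulr_ge0// mulr_ile1.
  + by rewrite mulr_ge0 ?step_ge0//= mulr_ile1 ?step_ge0 ?step_le1.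
- have r20 : 0 < r / 2 by rewrite divr_gt0.
  near=> x; rewrite /rho big1// => j _.
  suff sj : `|s j x| <= 1.
    by move: sj; rewrite ler_norml => /andP[s1 s2]; rewrite !step_eq1 ?mulr1//;
      lra.
  have xr : `|x0 - x| < r / 2.
    by near: x; move: r20; exact: (@cvgrPdist_lt _ _ _ _ _ id x0).1.
  rewrite normrM (gtr0_norm (divr_gt0 _ r0))// mulrC -ler_pdivlMr ?divr_gt0//.
  rewrite mul1r invf_div; apply: le_trans (ltW xr).
  rewrite distrC [leRHS]/Num.norm /= mx_normrE.
  have := (le_bigmax _ (fun i : 'I_1 * 'I_m => `|(x0 - x) i.1 i.2|) (0, j)).
  by rewrite /= !mxE; exact.
- move=> x; rewrite [ltRHS]/Num.norm /= mx_normrE => /bigmax_gtP[|[[i j] _ /=]].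
    by rewrite ltNge ltW.
  rewrite ord1 !mxE => rj; rewrite /rho (bigD1 j)//=.
  have [sp|sm] := leP 0 (x 0 j - x0 0 j).
    rewrite ger0_norm// in rj.
    rewrite [step (2 - _)]step_eq0 ?mul0r// subr_le0 /s mulrAC ler_pdivlMr//.
    by rewrite ler_pM2l// ltW.
  rewrite ltr0_norm// in rj.
  rewrite [step (2 + s j x)]step_eq0 ?mulr0 ?mul0r// -[s j x]opprK subr_le0.
  rewrite /s -mulrN mulrAC ler_pdivlMr// ler_pM2l// ltW.
Unshelve. all: by end_near. Qed.

End Bump.

(** * Normal form of skew-symmetric matrices *)
Section SkewNormalForm.
Context {R : realFieldType}.

Lemma skew_entry n (B : 'M[R]_n) i j : B^T = - B -> B i j = - B j i.
Proof. by move=> /matrixP/(_ j i); rewrite !mxE. Qed.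

Lemma skew_diag n (B : 'M[R]_n) i : B^T = - B -> B i i = 0.
Proof. by move=> /(@skew_entry _ _ i i); lra. Qed.

(** One step of symplectic Gram-Schmidt: subtracting the plane spanned by rows
    [i] and [j] puts the basis vectors [i] and [j] in the kernel, and the row
    space loses exactly this plane. *)
Lemma skew_reduce n (B : 'M[R]_n) i j : B^T = - B -> B i j != 0 ->
  let B' := B - (B i j)^-1 *:
    ((row i B)^T *m row j B - (row j B)^T *m row i B) in
  B'^T = - B' /\ (\rank B' + 2 <= \rank B)%N.
Proof.
move=> sB c0 B'; set c := B i j in c0 B' *.
have BE k l : B' k l = B k l - c^-1 * (B i k * B j l - B j k * B i l).
  by rewrite !mxE !big_ord1 !mxE.
split.
  by apply/matrixP => k l; rewrite [LHS]mxE [RHS]mxE !BE (skew_entry l k sB);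
    ring.
have B'E : B' = B - c^-1 *:
    ((row i B)^T *m row j B - (row j B)^T *m row i B) by [].
(* [U *m P] is invertible whereas [B' *m P = 0]: the rows [i] and [j] are
   independent modulo the row space of [B']. *)
clearbody B'; pose U := col_mx (row i B) (row j B).
pose P : 'M[R]_(n, 1 + 1) := row_mx (delta_mx i 0) (delta_mx j 0).
have rowd k l : row k B *m delta_mx l (0 : 'I_1) = (B k l)%:M.
  by rewrite -colE; apply/matrixP => x y; rewrite !ord1 !mxE eqxx mulr1n.
have cj : B j i = - c by rewrite (skew_entry j i sB).
have UP : U *m P = block_mx 0 c%:M (- c%:M) 0.
  by rewrite /U /P mul_col_row !rowd !(skew_diag _ sB) cj -/c raddf0 raddfN.
have UPu : row_free (U *m P).
  rewrite row_free_unit.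
  suff : (U *m P) *m ((- c ^- 2) *: (U *m P)) = 1%:M by move/mulmx1_unit => [].
  rewrite -scalemxAr UP mulmx_block !mul0mx !mulmx0 !add0r !addr0.
  rewrite mulmxN mulNmx -scalar_mxM -raddfN /= -scalar_mx_block scale_scalar_mx.
  by congr (_%:M); field.
have rU : \rank U = 2%N.
  apply/eqP; rewrite eqn_leq rank_leq_row /=.
  by have := mxrankM_maxl U P; rewrite (eqP UPu).
have B'P : B' *m P = 0.
  rewrite mul_mx_row -!colE -[RHS]row_mx0; congr row_mx.
    apply/matrixP => k l; rewrite !mxE BE cj (skew_diag _ sB).
    by rewrite (skew_entry i k sB); field.
  apply/matrixP => k l; rewrite !mxE BE (skew_diag _ sB) -/c.
  by rewrite (skew_entry j k sB); field.
have cap0 : (U :&: B')%MS = 0.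
  apply/eqP; rewrite -submx0; apply/rV_subP => z.
  rewrite sub_capmx => /andP[/submxP[y zU] /submxP[w zB]].
  have : z *m P = 0 by rewrite zB -mulmxA B'P mulmx0.
  rewrite zU -mulmxA => yUP; have -> : y = 0 by apply: (row_free_inj UPu);
    rewrite mul0mx.
  by rewrite mul0mx sub0mx.
rewrite addnC -rU -(mxrank_disjoint_sum cap0); apply: mxrankS.
rewrite addsmx_sub col_mx_sub !row_sub /=.
rewrite B'E addmx_sub// eqmx_opp scalemx_sub// addmx_sub ?eqmx_opp//.
  exact: submx_trans (submxMl _ _) (row_sub _ _).
exact: submx_trans (submxMl _ _) (row_sub _ _).
Qed.

Definition std_symplectic r : 'M[R]_(r + r) := block_mx 0 1%:M (- 1%:M) 0.

(** The rows of [c] come in [r] conjugate pairs; the rank bound makes them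
    linearly independent. *)
Lemma skew_normal_form n (B : 'M[R]_n) : B^T = - B ->
  exists r (c : 'M[R]_(r + r, n)),
    B = c^T *m std_symplectic r *m c /\ (r + r <= \rank B)%N.
Proof.
move=> sB.
suff [r [a [b [-> rB]]]] : exists r (a b : 'M[R]_(r, n)),
    B = a^T *m b - b^T *m a /\ (r + r <= \rank B)%N.
  exists r, (col_mx a b); split=> //.
  rewrite tr_col_mx mul_row_block !mulmx0 add0r addr0 mulmx1 mulmxN mulmx1.
  by rewrite mul_row_col mulNmx addrC.
have [m] := ubnP (\rank B); elim: m B sB => // m IH B sB rm.
have [->|/eqP B0] := eqVneq B 0.
  by exists 0%N, 0, 0; rewrite !mulmx0 subr0.
have [i [j c0]] : exists i j, B i j != 0.
  apply: contrapT => H; apply: B0; apply/matrixP => i j; rewrite mxE.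
  by apply/eqP/negPn/negP => H'; apply: H; exists i, j.
have [sB' rB'] := skew_reduce sB c0.
set B' := B - _ in sB' rB'.
have [|r [a [b [E ra]]]] := IH _ sB'.
  by rewrite addn2 in rB'; exact: leq_trans (ltnW rB') rm.
exists (1 + r)%N, (col_mx ((B i j)^-1 *: row i B) a), (col_mx (row j B) b);
  split.
  rewrite !tr_col_mx !mul_row_col opprD addrACA -E /B'.
  rewrite linearZ /= -scalemxAl -scalemxAr -scalerBr.
  by rewrite addrC subrK.
apply: leq_trans rB'; rewrite addnACA addnC leq_add2r//.
Qed.

End SkewNormalForm.

(** * Powers of a 2-form and its rank *)
Section Pfaffian.
Context {R : realFieldType}.

(** Position of the first ([b = false]) or second member of the [i]th pair in
    the enumeration of arguments used by the wedge power. *)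
Definition pair_idx d (i : 'I_d) (b : bool) : 'I_(d * 2).
Proof.
apply: (@Ordinal _ (i * 2 + b)); case: i b => i /= id b.
have : (i.+1 * 2 <= d * 2)%N by rewrite leq_mul2r id orbT.
by apply: leq_trans; rewrite mulSn addnC ltn_add2r; case: b.
Defined.

(** For skew-symmetric [M], [2 ^ d * d`!] times its Pfaffian. *)
Definition pfaffian_sum d (M : 'I_(d * 2) -> 'I_(d * 2) -> R) : R :=
  \sum_(s : 'S_(d * 2)) (-1) ^+ s *
    \prod_(i < d) M (s (pair_idx i false)) (s (pair_idx i true)).

Definition fix2_perm m (t : 'S_m) : 'S_(2 + m) :=
  lift_perm ord0 ord0 (lift_perm ord0 ord0 t).

Lemma fix2_perm_rshift m (t : 'S_m) j :
  fix2_perm t (rshift 2 j) = rshift 2 (t j).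
Proof.
have E k : rshift 2 k = lift ord0 (lift ord0 k) :> 'I_(2 + m) by apply: val_inj.
by rewrite !E /fix2_perm !lift_perm_lift.
Qed.

Lemma fix2_perm_lshift m (t : 'S_m) j :
  fix2_perm t (lshift m j) = lshift m j.
Proof.
have [->|->] : j = ord0 \/ j = lift ord0 ord0.
  by case: j => [[|[|//]] p]; [left|right]; apply: val_inj.
  have -> : lshift m ord0 = ord0 :> 'I_(2 + m) by apply: val_inj.
  exact: lift_perm_id.
have -> : lshift m (lift ord0 ord0) = lift ord0 ord0 :> 'I_(2 + m).
  by apply: val_inj.
by rewrite /fix2_perm lift_perm_lift lift_perm_id.
Qed.

Lemma odd_fix2_perm m (t : 'S_m) : odd_perm (fix2_perm t) = odd_perm t.
Proof. by rewrite /fix2_perm !odd_lift_perm. Qed.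

Lemma pair_idx_lift d (i : 'I_d) b :
  pair_idx (lift ord0 i) b = rshift 2 (pair_idx i b) :> 'I_(d.+1 * 2).
Proof. by apply: val_inj; rewrite /= /bump /= add1n mulSn addnA. Qed.

Lemma big_pair_idx d (F : 'I_(d * 2) -> R) :
  \prod_x F x = \prod_(i < d) (F (pair_idx i false) * F (pair_idx i true)).
Proof.
elim: d F => [|d IH] F; first by rewrite !big_ord0.
rewrite [RHS]big_ord_recl.
under [X in _ = _ * X]eq_bigr do rewrite !pair_idx_lift.
rewrite -(IH (fun x => F (rshift 2 x))).
rewrite (@big_split_ord _ _ _ 2 (d * 2) predT F) /=; congr (_ * _).
rewrite big_ord_recl big_ord1.
by congr (F _ * F _); apply: val_inj.
Qed.

End Pfaffian.

Section WedgePower.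
Context {R : realType}.

(** In the sum defining [wedge], a permutation [t] acting inside the second
    factor can be absorbed in the outer permutation, with the same sign; so the
    inner sum only repeats the outer one [(d * 2)`!] times. *)
Lemma wedge_pow_pfaffian n (B : 'M[R]_n) d : exists2 c : R, c != 0 &
  forall v, wedge_pow (form2 B) (d := d) v =
    c * pfaffian_sum (fun x y => bil B (v x) (v y)).
Proof.
elim: d => [|d [c c0 IH]].
  exists 1; first exact: oner_neq0.
  move=> v; rewrite mul1r /pfaffian_sum /=.
  rewrite (bigD1 1%g)//= [X in _ + X]big1 ?addr0 => [|s /eqP[]].
    by rewrite odd_perm1 expr0 big_ord0 mulr1.
  by apply/permP => -[].
pose K := (2`! * (d * 2)`!)%:R^-1 * c * ((d * 2)`!)%:R : R.
have fact0 k : k`!%:R != 0 :> R by rewrite pnatr_eq0 -lt0n fact_gt0.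
exists K.
  by rewrite !mulf_neq0// invr_neq0// natrM mulf_neq0.
move=> v; rewrite /= /wedge.
pose G (s : 'S_(2 + d * 2)) : R := (-1) ^+ s *
  (bil B (v (s (lshift (d * 2) ord0))) (v (s (lshift (d * 2) ord_max))) *
  \prod_(i < d) bil B (v (s (rshift 2 (pair_idx i false))))
                      (v (s (rshift 2 (pair_idx i true))))).
have pfE : pfaffian_sum (fun x y => bil B (v x) (v y)) = \sum_s G s.
  apply: eq_bigr => s _; rewrite big_ord_recl /G; congr (_ * (_ * _)).
    by congr (bil B (v (s _)) (v (s _))); apply: val_inj.
  by apply: eq_bigr => i _; rewrite !pair_idx_lift.
rewrite pfE /K -!mulrA; congr (_ * _).
transitivity (\sum_(s : 'S_(2 + d * 2)) c * \sum_(t :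
  'S_(d * 2)) G (fix2_perm t * s)%g).
  apply: eq_bigr => s _; rewrite IH mulrCA; congr (c * _).
  rewrite /pfaffian_sum mulr_sumr; apply: eq_bigr => t _.
  rewrite /G odd_permM odd_fix2_perm signr_addb !permM !fix2_perm_lshift.
  under [in RHS]eq_bigr do rewrite !permM !fix2_perm_rshift.
  by rewrite mulrACA [in RHS](mulrC ((-1) ^+ t)).
rewrite -mulr_sumr; congr (c * _).
rewrite exchange_big /=.
transitivity (\sum_(t : 'S_(d * 2)) \sum_s G s).
  apply: eq_bigr => t _.
  by rewrite [RHS](reindex_inj (mulgI (fix2_perm t))).
by rewrite sumr_const card_Sn mulr_natl.
Qed.

Definition unpair d (x : 'I_(d * 2)) : 'I_d.
Proof.
apply: (@Ordinal _ (x./2)); case: x => x /= xd.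
by rewrite ltn_half_double -muln2.
Defined.

Lemma unpairK d (i : 'I_d) b : unpair (pair_idx i b) = i.
Proof.
by apply: val_inj; rewrite /= muln2 addnC half_bit_double.
Qed.

Lemma odd_pair_idx d (i : 'I_d) b : odd (pair_idx i b) = b.
Proof. by rewrite /= muln2 oddD odd_double oddb. Qed.

(** Row [2 i] picks the row [k i] of the normal form, and row [2 i + 1] its
    symplectic conjugate. *)
Definition selection d r (k : {ffun 'I_d ->
  'I_(r + r)}) : 'M[R]_(d * 2, r + r) :=
  \matrix_(x, y) if odd x then std_symplectic r (k (unpair x)) y
                 else (k (unpair x) == y)%:R.

(** Each entry of the Gram matrix is a sum over the rows of the normal form;
    distributing the product over these sums leaves, for every choice [k] of
    rows, the Leibniz expansion of a determinant. *)
Lemma pfaffian_sum_det d r (Y : 'M[R]_(r + r, d * 2)) :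
  pfaffian_sum (fun x y => (Y^T *m std_symplectic r *m Y) x y) =
  \sum_(k : {ffun 'I_d -> 'I_(r + r)}) \det (selection k *m Y).
Proof.
pose J : 'M[R]_(r + r) := std_symplectic r.
have gramE x y : (Y^T *m J *m Y) x y = \sum_l Y l x * (J *m Y) l y.
  by rewrite -mulmxA mxE; apply: eq_bigr => l _; rewrite mxE.
transitivity (\sum_(s : 'S_(d * 2)) \sum_(k : {ffun 'I_d -> 'I_(r + r)})
   (-1) ^+ s * \prod_(i < d) (Y (k i) (s (pair_idx i false)) *
      (J *m Y) (k i) (s (pair_idx i true)))).
  apply: eq_bigr => s _; rewrite -mulr_sumr; congr (_ * _).
  under eq_bigr do rewrite gramE.
  by rewrite bigA_distr_bigA.
rewrite exchange_big /=; apply: eq_bigr => k _; apply: eq_bigr => s _.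
congr (_ * _); rewrite big_pair_idx; apply: eq_bigr => i _.
congr (_ * _); rewrite mxE.
  rewrite (bigD1 (k i))// !mxE odd_pair_idx unpairK eqxx mul1r.
  rewrite big1 => [|l /andP[_ lk]]; first exact/esym/addr0.
  by rewrite !mxE odd_pair_idx unpairK eq_sym (negbTE lk) mul0r.
by rewrite mxE; apply: eq_bigr => l _; rewrite [in RHS]mxE odd_pair_idx unpairK.
Qed.

Lemma pfaffian_sum_small d r (Y : 'M[R]_(r + r, d * 2)) : (r < d)%N ->
  pfaffian_sum (fun x y => (Y^T *m std_symplectic r *m Y) x y) = 0.
Proof.
move=> rd; rewrite pfaffian_sum_det big1// => k _.
apply/eqP; rewrite -[_ == 0]negbK -unitfE -unitmxE -row_free_unit.
apply/negP => /eqP H; have := mxrankM_maxr (selection k) Y.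
rewrite H => /leq_trans/(_ (rank_leq_row Y)).
by rewrite muln2 -addnn leqNgt -addSn leq_add// ltnW.
Qed.

Definition split_idx d (x : 'I_(d * 2)) : 'I_(d + d) :=
  if odd x then rshift d (unpair x) else lshift d (unpair x).

(** Reorders interleaved pairs into the first members followed by the second
    members. *)
Definition unshuffle d : 'M[R]_(d * 2, d + d) :=
  \matrix_(x, y) (split_idx x == y)%:R.

Lemma split_idx_inj d : injective (@split_idx d).
Proof.
move=> x y; rewrite /split_idx => E; apply: val_inj => /=.
rewrite -(odd_double_half x) -(odd_double_half y).
case: ifP E => ox; case: ifP => oy E.
- by move/rshift_inj: E => /(congr1 val) /= ->.
- by move/eqP: E; rewrite eq_rlshift.
- by move/eqP: E; rewrite eq_lrshift.
- by move/lshift_inj: E => /(congr1 val) /= ->.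
Qed.

Lemma unshuffle_mul d p (A : 'M[R]_(d + d, p)) x y :
  (unshuffle d *m A) x y = A (split_idx x) y.
Proof.
rewrite mxE (bigD1 (split_idx x))//= mxE eqxx mul1r big1 ?addr0// => z zx.
by rewrite mxE eq_sym (negbTE zx) mul0r.
Qed.

Lemma unshuffleK d : unshuffle d *m (unshuffle d)^T = 1%:M.
Proof.
apply/matrixP => x y.
by rewrite unshuffle_mul !mxE (inj_eq (@split_idx_inj d)) eq_sym.
Qed.

Definition rot_part d (k : {ffun 'I_d -> 'I_(d + d)}) (b : bool) : 'M[R]_d :=
  diag_mx (\row_i (if fintype.split (k i) is inl _ then ~~ b else b)%:R).

Definition base_part d (k : {ffun 'I_d -> 'I_(d + d)}) : 'M[R]_d :=
  \matrix_(i, j) ((match fintype.split (k i) with inl l => l | inr l => l end)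
    == j)%:R.

(** Up to the reordering, a choice of rows is a choice of pairs ([base_part])
    followed by quarter turns in some of the planes ([rot_part]). *)
Lemma selection_factor d (k : {ffun 'I_d -> 'I_(d + d)}) :
  selection k = unshuffle d *m
    (block_mx (rot_part k false) (rot_part k true)
              (- rot_part k true) (rot_part k false) *m
     block_mx (base_part k) 0 0 (base_part k)).
Proof.
rewrite mulmx_block !mulmx0 !add0r !addr0.
apply/matrixP => x y; rewrite unshuffle_mul mxE /split_idx /std_symplectic.
rewrite -(splitK y) -[k (unpair x)]splitK /=.
have rotE b (A : 'M[R]_d) i j : (rot_part k b *m A) i j =
    (if fintype.split (k i) is inl _ then ~~ b else b)%:R * A i j.
  by rewrite mul_diag_mx !mxE.
case: ifP => ox; case: (fintype.split y) => y' /=.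
- rewrite block_mxEdl mulNmx [RHS]mxE rotE [base_part _ _ _]mxE.
  case: (fintype.split (k (unpair x))) => l /=.
    by rewrite block_mxEul mxE mul0r oppr0.
  by rewrite block_mxEdl !mxE mul1r.
- rewrite block_mxEdr rotE [base_part _ _ _]mxE.
  case: (fintype.split (k (unpair x))) => l /=.
    by rewrite block_mxEur !mxE mul1r.
  by rewrite block_mxEdr !mxE mul0r.
- rewrite block_mxEul rotE [base_part _ _ _]mxE.
  case: (fintype.split (k (unpair x))) => l /=.
    by rewrite (inj_eq (@lshift_inj _ _)) mul1r.
  by rewrite eq_rlshift mul0r.
- rewrite block_mxEur rotE [base_part _ _ _]mxE.
  case: (fintype.split (k (unpair x))) => l /=.
    by rewrite eq_lrshift mul0r.
  by rewrite (inj_eq (@rshift_inj _ _)) mul1r.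
Qed.

(** A quarter turn in the planes selected by the idempotent [D] is a product of
    three shears. *)
Lemma det_rot d (k : {ffun 'I_d -> 'I_(d + d)}) :
  \det (block_mx (rot_part k false) (rot_part k true)
              (- rot_part k true) (rot_part k false)) = 1.
Proof.
set D := rot_part k true.
have DD : D *m D = D.
  rewrite /D /rot_part mulmx_diag; congr diag_mx.
  by apply/rowP => i; rewrite !mxE; case: fintype.split => _;
    rewrite ?mulr0 ?mulr1.
have E : rot_part k false = 1%:M - D.
  apply/matrixP => i j; rewrite !mxE; case: fintype.split => _ /=.
    by rewrite mul0rn subr0.
  by rewrite mul0rn subrr.
pose U := block_mx 1%:M D 0 1%:M; pose L := block_mx 1%:M 0 (- D) 1%:M.
have -> : block_mx (rot_part k false) D (- D) (rot_part k false) = U *m L *m U.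
  rewrite E /U /L !mulmx_block !mul1mx !mulmx1 !mul0mx !mulmx0 !addr0 !add0r.
  rewrite mulmxN mulNmx DD mulmxDl mul1mx mulNmx DD subrr add0r.
  by rewrite [- D + _]addrC.
by rewrite !det_mulmx /U /L !det_ublock !det_lblock !det1 !mulr1.
Qed.

(** For sizes such as [d * 2] and [d + d], equal but not convertible. *)
Lemma det_mulmx_mid m p (h : p = m) (E : 'M[R]_(m, p)) X (Y : 'M[R]_(p, m)) :
  \det (E *m X *m Y) = \det X * \det (E *m Y).
Proof. by subst p; rewrite !det_mulmx mulrCA mulrA. Qed.

(** All the terms have the same sign: relative to the unshuffled basis, each
    selection has determinant [\det (base_part k) ^+ 2]. *)
Lemma pfaffian_sum_neq0 d (Y : 'M[R]_(d + d, d * 2)) :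
  \det (unshuffle d *m Y) != 0 ->
  pfaffian_sum (fun x y => (Y^T *m std_symplectic d *m Y) x y) != 0.
Proof.
move=> Y0; rewrite pfaffian_sum_det.
have dd : (d + d = d * 2)%N by rewrite muln2 addnn.
under eq_bigr do rewrite selection_factor (det_mulmx_mid dd) det_mulmx det_rot
  mul1r det_ublock.
rewrite -mulr_suml mulf_neq0// gt_eqF//.
have H k : 0 <= \det (base_part k) * \det (base_part (d := d) k).
  by rewrite -expr2 sqr_ge0.
rewrite (bigD1 [ffun i => lshift d i])//= ltr_pwDl//; last exact: sumr_ge0.
suff -> : base_part [ffun i => lshift d i] = 1%:M by rewrite det1 mulr1.
apply/matrixP => i j; rewrite !mxE ffunE.
by rewrite -[lshift d i]/(unsplit (inl i)) unsplitK.
Qed.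

Lemma skew_odd_rank m (B : 'M[R]_m) : odd m -> B^T = - B -> (\rank B < m)%N.
Proof.
move=> om sB; rewrite ltn_neqAle rank_leq_row andbT.
apply/negP => /eqP rB; have : B \in unitmx by rewrite -row_free_unit; apply/eqP.
rewrite unitmxE unitfE; suff -> : \det B = 0 by rewrite eqxx.
have : \det B = - \det B.
  by rewrite -{1}det_tr sB -scaleN1r detZ -signr_odd om expr1 mulN1r.
by lra.
Qed.

Lemma wedge_pow_rank d (B : 'M[R]_((2 * d).+1)) : B^T = - B ->
  (exists v, wedge_pow (form2 B) (d := d) v != 0) <-> \rank B = (2 * d)%N.
Proof.
move=> sB; have [c c0 HB] := wedge_pow_pfaffian B d.
have [r [C [BE rC]]] := skew_normal_form sB.
have om : odd (2 * d).+1 by rewrite /= oddM.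
have rB := skew_odd_rank om sB.
have dd : (d + d = 2 * d)%N by rewrite mul2n addnn.
pose V (v : 'I_(d * 2) -> 'rV[R]_((2 * d).+1)) := \matrix_x v x.
have gramE v : (fun x y => bil B (v x) (v y)) =
    (fun x y => ((C *m (V v)^T)^T *m std_symplectic r *m (C *m (V v)^T)) x y).
  apply/funext => x; apply/funext => y.
  rewrite trmx_mul trmxK -!mulmxA (mulmxA C^T) (mulmxA (C^T *m _)) -BE mulmxA.
  rewrite /bil -[v x in LHS](rowK v) -[v y in LHS](rowK v) -/(V v).
  rewrite tr_row -row_mul.
  by rewrite !mxE; apply: eq_bigr => l _; rewrite !mxE.
split=> [[v]|rk].
  rewrite HB gramE => H; apply/eqP; rewrite eqn_leq -ltnS rB /=.
  suff dr : (d <= r)%N by apply: leq_trans rC; rewrite -dd leq_add.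
  rewrite leqNgt; apply/negP => rd.
  by move: H; rewrite pfaffian_sum_small ?mulr0 ?eqxx//; lia.
have rr : r = d.
  have := mxrankM_maxr (C^T *m std_symplectic r) C; rewrite -BE rk.
  by move=> /leq_trans/(_ (rank_leq_row C)); move: rC; rewrite rk; lia.
subst r.
have fC : row_free C.
  rewrite /row_free eqn_leq rank_leq_row /=; apply: leq_trans rC _.
  by rewrite {1}BE; exact: mxrankM_maxr.
exists (fun x => row x (pinvmx C *m (unshuffle d)^T)^T).
rewrite HB mulf_neq0// gramE; apply: pfaffian_sum_neq0.
have -> : V (fun x => row x (pinvmx C *m (unshuffle d)^T)^T) =
    (pinvmx C *m (unshuffle d)^T)^T.
  by apply/matrixP => x y; rewrite !mxE.
by rewrite trmxK (mulmxA C) (mulmxVp fC) mul1mx unshuffleK det1 oner_neq0.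
Qed.

End WedgePower.

(** * The algebra of a torsion-free connection preserving a corank one form *)
Section Christoffel.
Context {R : realFieldType} {n : nat}.
Implicit Types (W : 'M[R]_n).

Definition bordered W (e0 : 'rV[R]_n) : 'M[R]_n := W + e0^T *m e0.

Lemma rV_sqr_eq0 (u : 'rV[R]_n) : u *m u^T = 0 -> u = 0.
Proof.
move=> /matrixP/(_ 0 0); rewrite !mxE => /eqP.
rewrite psumr_eq0 => [|i _]; last by rewrite mxE -expr2 sqr_ge0.
move=> /allP H; apply/rowP => i; rewrite mxE.
by have := H i (mem_index_enum _); rewrite mxE mulf_eq0 orbb => /eqP.
Qed.

Lemma rV_sqr_ge0 (u : 'rV[R]_n) : 0 <= (u *m u^T) 0 0.
Proof. by rewrite mxE sumr_ge0// => i _; rewrite mxE -expr2 sqr_ge0. Qed.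

Lemma skew_mul_tr W (u : 'rV[R]_n) : W^T = - W -> u *m W *m u^T = 0.
Proof.
move=> sW; apply/matrixP => i j; rewrite !ord1 [RHS]mxE.
have : (u *m W *m u^T)^T = - (u *m W *m u^T).
  by rewrite !trmx_mul trmxK sW mulNmx mulmxN mulmxA.
by move=> /matrixP/(_ 0 0); rewrite [LHS]mxE [RHS]mxE; lra.
Qed.

Lemma row_mx11_eq0 (u v : 'rV[R]_n) : u *m v^T *m (u *m v^T)^T = 0 ->
  u *m v^T = 0.
Proof.
move=> /matrixP/(_ 0 0); rewrite mxE big_ord1 [_^T _ _]mxE [RHS]mxE -expr2.
by move/eqP; rewrite sqrf_eq0 => /eqP H; apply/matrixP => i j;
  rewrite !ord1 H mxE.
Qed.

(** The spanning vector [e0] of the kernel of [W] works: if [u] is killed by the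
    bordered matrix then pairing with [u] gives [(u e0^T)^2 = 0], so [u] lies in
    the kernel of [W] and is orthogonal to it. *)
Lemma bordered_unit W : W^T = - W -> \rank W = n.-1 -> (0 < n)%N ->
  exists e0, bordered W e0 \in unitmx.
Proof.
move=> sW rW n0.
have rk : \rank (kermx W) = 1%N.
  by rewrite mxrank_ker rW; case: (n) n0 => // m _; rewrite subSnn.
have kn0 : kermx W != 0 by rewrite -mxrank_eq0 rk.
pose e0 := nz_row (kermx W); exists e0.
have e00 : e0 != 0 by rewrite nz_row_eq0.
have e0k : (e0 <= kermx W)%MS by exact: nz_row_sub.
have ke : (kermx W <= e0)%MS.
  have re : \rank e0 = 1%N by rewrite rank_rV e00.
  by have := mxrank_leqif_sup e0k; rewrite re rk => -[_ <-].
rewrite -row_free_unit -kermx_eq0; apply/eqP/row_matrixP => i.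
rewrite row0; set u := row i _.
have : u *m bordered W e0 = 0 by apply/sub_kermxP; exact: row_sub.
rewrite /bordered mulmxDr mulmxA => uN.
have ue0 : u *m e0^T = 0.
  apply: row_mx11_eq0; have := congr1 (mulmx^~ u^T) uN.
  rewrite mulmxDl skew_mul_tr// add0r mul0mx => <-.
  by rewrite trmx_mul trmxK !mulmxA.
move: uN; rewrite ue0 mul0mx addr0 => /sub_kermxP/submx_trans/(_ ke).
move=> /sub_rVP[a ua]; move: ue0; rewrite ua -scalemxAl => /eqP.
rewrite scaler_eq0 => /orP[/eqP ->|/eqP /rV_sqr_eq0 ->];
  first by rewrite scale0r.
by rewrite scaler0.
Qed.

Section Pointwise.
Variables (W : 'M[R]_n) (e0 : 'rV[R]_n).
Hypotheses (sW : W^T = - W) (rW : (\rank W < n)%N).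
Hypothesis Nu : bordered W e0 \in unitmx.

Definition kernel_vector : 'rV[R]_n := e0 *m invmx (bordered W e0).

Let e := kernel_vector.

Let eN : e *m W + (e *m e0^T) *m e0 = e0.
Proof. by rewrite -mulmxA -mulmxDr mulmxKV. Qed.

(** With [s] the scalar product of [e] and [e0], the equation [e W + s e0 = e0]
    paired with [e] gives [s^2 = s].  If [s] were 0 then [e0] would be in the
    image of [W], hence orthogonal to its kernel, and the bordered matrix would
    be singular. *)
Lemma kernel_vectorP : e *m W = 0 /\ e *m e0^T = 1%:M.
Proof.
pose s := (e *m e0^T) 0 0.
have sE : e *m e0^T = s%:M by rewrite [LHS]mx11_scalar.
have s2 : s * s = s.
  have := congr1 (mulmx^~ e^T) eN; rewrite mulmxDl skew_mul_tr// add0r.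
  have -> : e0 *m e^T = s%:M.
    by rewrite -[LHS]trmxK trmx_mul trmxK sE tr_scalar_mx.
  rewrite -mulmxA.
  have -> : e0 *m e^T = s%:M.
    by rewrite -[LHS]trmxK trmx_mul trmxK sE tr_scalar_mx.
  by rewrite sE -scalar_mxM => /matrixP/(_ 0 0); rewrite !mxE eqxx !mulr1n.
have [s0|s0] := eqVneq s 0; last first.
  have s1 : s = 1 by apply: (mulfI s0); rewrite s2 mulr1.
  rewrite sE s1; split=> //; move: eN.
  by rewrite sE s1 mul1mx => /(canRL (addrK _)); rewrite subrr.
have eW : e *m W = e0 by move: eN; rewrite sE s0 raddf0 mul0mx addr0.
have : kermx W != 0.
  by rewrite -mxrank_eq0 mxrank_ker subn_eq0 -ltnNge.
rewrite -nz_row_eq0; set f := nz_row _ => f0.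
have fW : f *m W = 0 by apply/sub_kermxP; exact: nz_row_sub.
have fe0 : f *m e0^T = 0.
  by rewrite -eW trmx_mul sW mulNmx mulmxN mulmxA fW mul0mx oppr0.
have : f *m bordered W e0 = 0 by rewrite mulmxDr fW mulmxA fe0 mul0mx addr0.
move=> /(congr1 (mulmx^~ (invmx (bordered W e0)))); rewrite mulmxK// mul0mx.
by move=> /eqP; rewrite (negbTE f0).
Qed.

(** On the annihilator of the kernel vector the inverse of the bordered matrix
    inverts [W]. *)
Lemma bordered_solve (t : 'rV[R]_n) : t *m e^T = 0 ->
  t *m invmx (bordered W e0) *m W = t.
Proof.
move=> te; set y := t *m _.
have yN : y *m W + (y *m e0^T) *m e0 = t.
  by rewrite -mulmxA -mulmxDr mulmxKV.
have [eW ee] := kernel_vectorP.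
have We : W *m e^T = 0.
  by rewrite -[LHS]trmxK trmx_mul trmxK sW mulmxN eW oppr0 trmx0.
have : (y *m W + (y *m e0^T) *m e0) *m e^T = 0 by rewrite yN.
rewrite mulmxDl -[y *m W *m _]mulmxA We mulmx0 add0r -[_ *m e^T]mulmxA.
have -> : e0 *m e^T = 1%:M by rewrite -[LHS]trmxK trmx_mul trmxK ee
  tr_scalar_mx.
by rewrite mulmx1 => H; move: yN; rewrite H mul0mx addr0.
Qed.

Variable A : 'I_n -> 'M[R]_n.

(** Minus the value on the kernel vector of the tensor that solves the
    nondegenerate case; [defect1] is its contraction with the kernel vector. *)
Definition defect j k : R := - 3^-1 * \sum_l (A j k l + A k j l) * e 0 l.

Definition defect1 j : R := \sum_k defect j k * e 0 k.

(** The first term solves the equation when [W] is invertible.  The rest is the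
    totally symmetric tensor whose contraction with the kernel vector [e] is
    [defect]: as [e0] takes the value 1 on [e], it is [e0] times [defect],
    symmetrized, minus the contributions counted twice. *)
Definition contorsion i j k : R := 3^-1 * (A i j k + A j i k)
  + (e0 0 i * defect j k + e0 0 j * defect i k + e0 0 k * defect i j)
  - (e0 0 i * e0 0 j * defect1 k + e0 0 j * e0 0 k * defect1 i
     + e0 0 i * e0 0 k * defect1 j).

Definition christoffel i : 'M[R]_n :=
  (\matrix_(j, k) contorsion i j k) *m invmx (bordered W e0).

Hypothesis sA : forall i j k, A i j k = - A i k j.
Hypothesis cA : forall i j k, A i j k + A j k i + A k i j = 0.

Lemma defectC j k : defect j k = defect k j.
Proof. by congr (_ * _); apply: eq_bigr => l _; rewrite addrC. Qed.

Lemma contorsionC i j k : contorsion i j k = contorsion j i k.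
Proof. by rewrite /contorsion (defectC i j); ring. Qed.

Lemma contorsionB i j k : contorsion i j k - contorsion i k j = A i j k.
Proof.
rewrite -[RHS]subr0 -(mulr0 3^-1) -(cA i j k).
by rewrite /contorsion (defectC k j) (sA i k j) (sA j i k); field.
Qed.

(** A skew form vanishes on equal arguments, so [A] contracted three times with
    the same vector is 0. *)
Lemma defect_kernel : \sum_j defect1 j * e 0 j = 0.
Proof.
suff H : \sum_j \sum_k \sum_l A j k l * e 0 l * e 0 k * e 0 j = 0.
  under eq_bigr => j _.
    rewrite /defect1 mulr_suml.
    under eq_bigr => k _.
      rewrite /defect mulr_sumr mulr_suml mulr_suml.
      under eq_bigr => l _.
        have -> : - 3^-1 * ((A j k l + A k j l) * e 0 l) * e 0 k * e 0 j =
          - 3^-1 * (A j k l * e 0 l * e 0 k * e 0 j) +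
          - 3^-1 * (A k j l * e 0 l * e 0 j * e 0 k) by ring.
        over.
      rewrite big_split/= -!mulr_sumr; over.
    rewrite big_split/= -!mulr_sumr; over.
  rewrite big_split/= -!mulr_sumr H [X in _ + _ * X]exchange_big /= H.
  by rewrite mulr0 addr0.
apply: big1 => j _.
suff : \sum_k \sum_l A j k l * e 0 l * e 0 k * e 0 j =
   - \sum_k \sum_l A j k l * e 0 l * e 0 k * e 0 j by lra.
rewrite {1}exchange_big /= -sumrN; apply: eq_bigr => k _.
rewrite -sumrN; apply: eq_bigr => l _.
by rewrite (sA j l k); ring.
Qed.

Lemma contorsion_kernel i j : \sum_k contorsion i j k * e 0 k = 0.
Proof.
have ee : \sum_k e0 0 k * e 0 k = 1.
  have [_ /matrixP/(_ 0 0)] := kernel_vectorP; rewrite !mxE eqxx mulr1n => <-.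
  by apply: eq_bigr => k _; rewrite !mxE mulrC.
have lin (p q b c c' : R) (f g h : 'I_n -> R) :
    \sum_k (3^-1 * (A i j k + A j i k) + (p * f k + q * g k + e0 0 k * b)
       - (p * q * h k + q * e0 0 k * c + p * e0 0 k * c')) * e 0 k =
    - (- 3^-1 * \sum_k (A i j k + A j i k) * e 0 k)
    + (p * (\sum_k f k * e 0 k) + q * (\sum_k g k * e 0 k)
       + b * \sum_k e0 0 k * e 0 k)
    - (p * q * (\sum_k h k * e 0 k) + (q * c + p * c') * \sum_k e0 0 k * e 0 k).
  rewrite !mulr_sumr -!big_split /= -!sumrN -!big_split /=.
  by apply: eq_bigr => k _; ring.
rewrite lin.
have -> : - 3^-1 * (\sum_k (A i j k + A j i k) * e 0 k) = defect i j by [].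
have E m : \sum_k defect m k * e 0 k = defect1 m by [].
by rewrite !E ee defect_kernel; ring.
Qed.

Lemma christoffelC i j : row j (christoffel i) = row i (christoffel j).
Proof.
rewrite /christoffel !row_mul; congr (_ *m _); apply/rowP => k.
by rewrite !mxE contorsionC.
Qed.

(** The rows of [contorsion] vanish on the kernel vector, so they are multiples
    of [W]; what remains is the identity for [contorsion]. *)
Lemma christoffelP i : A i = christoffel i *m W + W *m (christoffel i)^T.
Proof.
have GW : christoffel i *m W = \matrix_(j, k) contorsion i j k.
  apply/row_matrixP => j; rewrite !row_mul; apply: bordered_solve.
  apply/matrixP => x y; rewrite !ord1 !mxE -[RHS](contorsion_kernel i j).
  by apply: eq_bigr => k _; rewrite !mxE.
have -> : W *m (christoffel i)^T = - (christoffel i *m W)^T.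
  by rewrite (trmx_mul (christoffel i) W) sW mulNmx opprK.
rewrite GW; apply/matrixP => j k; rewrite !mxE.
by rewrite contorsionB.
Qed.

End Pointwise.
End Christoffel.

(** * Calculus in charts *)
Section ChartCalculus.
Context {R : realType} {n : nat} {M : smooth_manifold R n}.
Implicit Types (c : chart R n M) (p q : M) (f g : M -> R) (u v : 'rV[R]_n).

Definition around c p := atlas c /\ Defs.dom c p.

Lemma around_chart_at p : around (chart_at p) p.
Proof. by rewrite /around /chart_at; case: cid2. Qed.

Lemma near_around c p : around c p -> \forall q \near p, around c q.
Proof.
move=> [ac dc]; have : \forall q \near p, Defs.dom c q.
  by apply: open_nbhs_nbhs; split=> //; exact: dom_open.
by apply: filterS.
Qed.

Lemma near_cod c p : around c p -> \forall y \near c p, cod c y.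
Proof.
move=> [ac dc]; apply: open_nbhs_nbhs; split; first exact: cod_open.
exact: coord_cod.
Qed.

Lemma near_icoord c p (P : M -> Prop) : around c p ->
  (\forall q \near p, P q) -> \forall y \near c p, P (icoord c y).
Proof.
move=> [ac dc]; rewrite -{1}(coordK dc) => nP.
exact: (icoord_continuous (coord_cod dc)).
Qed.

Lemma near_coord c p (P : 'rV[R]_n -> Prop) : around c p ->
  (\forall y \near c p, P y) -> \forall q \near p, P (c q).
Proof. by move=> [ac dc] nP; exact: (Defs.coord_continuous dc). Qed.

Lemma smooth_at_transition c c' p j : around c p -> around c' p ->
  smooth_at (fun y => c' (icoord c y) 0 j) (c p).
Proof.
move=> cp c'p; have [ac dc] := cp; have [ac' dc'] := c'p.
apply: (smooth_on_smooth_at_rV j (atlas_smooth ac ac')).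
by apply: filterS2 (near_cod cp) (near_icoord cp (near_around c'p)) => y cy [].
Qed.

(** Smoothness at one point, for functions that need not be smooth elsewhere. *)
Definition fsmooth f p := forall c, around c p ->
  smooth_at (f \o icoord c) (c p).

Lemma near_transition (T : Type) (f : M -> T) c c' p : around c p ->
  around c' p ->
  \forall y \near c p, (f \o icoord c') (c' (icoord c y)) = f (icoord c y).
Proof.
move=> cp c'p; have := near_icoord cp (near_around c'p).
by apply: filterS => y [_ d] /=; rewrite coordK.
Qed.

(** One chart suffices, because transition maps are smooth. *)
Lemma fsmooth_chart f c p : around c p -> smooth_at (f \o icoord c) (c p) ->
  fsmooth f p.
Proof.
move=> cp Hf c' c'p; have [ac dc] := cp; have [ac' dc'] := c'p.
have Hf' : smooth_at (f \o icoord c) (c (icoord c' (c' p))) by rewrite coordK.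
have := smooth_at_comp_rV (fun j => smooth_at_transition j c'p cp) Hf'.
by apply: smooth_at_congr; exact: near_transition.
Qed.

Lemma fsmooth_congr f g p : (\forall q \near p, f q = g q) -> fsmooth f p ->
  fsmooth g p.
Proof.
move=> fg Hf c cp; apply: smooth_at_congr (Hf c cp).
exact: (near_icoord cp fg).
Qed.

Lemma fsmooth_cst (a : R) p : fsmooth (fun=> a) p.
Proof. by move=> c cp; exact: smooth_at_cst. Qed.
#[local] Arguments fsmooth_cst a p : clear implicits.

Lemma fsmoothD f g p : fsmooth f p -> fsmooth g p ->
  fsmooth (fun q => f q + g q) p.
Proof. by move=> Hf Hg c cp; exact: smooth_atD (Hf c cp) (Hg c cp). Qed.

Lemma fsmoothM f g p : fsmooth f p -> fsmooth g p ->
  fsmooth (fun q => f q * g q) p.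
Proof. by move=> Hf Hg c cp; exact: smooth_atM (Hf c cp) (Hg c cp). Qed.

Lemma fsmoothN f p : fsmooth f p -> fsmooth (fun q => - f q) p.
Proof.
move=> Hf; apply: fsmooth_congr (fsmoothM (fsmooth_cst (-1) p) Hf).
by apply: filterE => q; rewrite mulN1r.
Qed.

Lemma fsmoothB f g p : fsmooth f p -> fsmooth g p ->
  fsmooth (fun q => f q - g q) p.
Proof. by move=> Hf Hg; exact: fsmoothD Hf (fsmoothN Hg). Qed.

Lemma fsmoothV f p : f p != 0 -> fsmooth f p -> fsmooth (fun q => (f q)^-1) p.
Proof.
move=> fp Hf c cp; have [_ dc] := cp.
by apply: smooth_atV (Hf c cp); rewrite /= coordK.
Qed.

Lemma fsmooth_sum I (r : seq I) (P : pred I) (f : I -> M -> R) p :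
  (forall i, P i -> fsmooth (f i) p) -> fsmooth (fun q => \sum_(i <- r | P i) f
    i q) p.
Proof.
move=> Hf c cp; apply: (@smooth_at_sum _ _ _ r P (fun i => f i \o icoord c)) =>
  i Pi.
exact: Hf.
Qed.

Lemma fsmooth_prod I (r : seq I) (P : pred I) (f : I -> M -> R) p :
  (forall i, P i -> fsmooth (f i) p) -> fsmooth (fun q => \prod_(i <- r | P i)
    f i q) p.
Proof.
move=> Hf c cp; apply: (@smooth_at_prod _ _ _ r P (fun i => f i \o icoord c))
  => i Pi.
exact: Hf.
Qed.

Lemma fsmooth_coord c p j : around c p -> fsmooth (fun q => c q 0 j) p.
Proof.
move=> cp; apply: (fsmooth_chart cp).
apply: smooth_at_congr (smooth_at_coord (c p) j).
by apply: filterS (near_cod cp) => y cy /=; rewrite icoordK.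
Qed.

(** The derivative along the constant field [u] of the chart [c].  It is known
    only through the equation [cderiveE], so that comparing two derivatives
    never unfolds the limits which define them. *)
Fact cderive_sealed : {D : chart R n M -> 'rV[R]_n -> (M -> R) -> M -> R |
  forall c u f p, D c u f p = 'D_u (f \o icoord c) (c p)}.
Proof. by exists (fun c u f p => 'D_u (f \o icoord c) (c p)). Qed.

Definition cderive := sval cderive_sealed.

Lemma cderiveE c u f p : cderive c u f p = 'D_u (f \o icoord c) (c p).
Proof. exact: svalP cderive_sealed c u f p. Qed.

Lemma cderive_near c u f p : around c p ->
  \forall y \near c p, (cderive c u f \o icoord c) y = 'D_u (f \o icoord c) y.
Proof.
by move=> cp; apply: filterS (near_cod cp) => y cy; rewrite /= cderiveE icoordK.
Qed.

Lemma fsmooth_cderive c u f p : around c p -> fsmooth f p ->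
  fsmooth (cderive c u f) p.
Proof.
move=> cp Hf; apply: (fsmooth_chart cp).
apply: smooth_at_congr (smooth_at_derive u (Hf c cp)).
by apply: filterS (cderive_near u f cp) => y ->.
Qed.

Lemma cderive_congr c u f g p : around c p -> (\forall q \near p, f q = g q) ->
  cderive c u f p = cderive c u g p.
Proof. by move=> cp fg; rewrite !cderiveE; apply: near_eq_derive;
  exact: (near_icoord cp fg). Qed.

Lemma cderive_cst c u (a : R) p : cderive c u (fun=> a) p = 0.
Proof. by rewrite cderiveE; exact: derive_cst. Qed.

Lemma cderiveD c u f g p : around c p -> fsmooth f p -> fsmooth g p ->
  cderive c u (fun q => f q + g q) p = cderive c u f p + cderive c u g p.
Proof.
move=> cp Hf Hg; rewrite !cderiveE; apply:
  (@deriveD _ _ _ (f \o icoord c) (g \o icoord c)).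
  exact: diff_derivable (smooth_at_differentiable (Hf c cp)).
exact: diff_derivable (smooth_at_differentiable (Hg c cp)).
Qed.

Lemma cderiveM c u f g p : around c p -> fsmooth f p -> fsmooth g p ->
  cderive c u (fun q => f q * g q) p = cderive c u f p * g p + f p * cderive c
    u g p.
Proof.
move=> cp Hf Hg; have [_ dc] := cp; rewrite !cderiveE.
rewrite [LHS](@deriveM _ _ (f \o icoord c) (g \o icoord c)).
- by rewrite /= !coordK// addrC; congr (_ + _); exact: mulrC.
- exact: diff_derivable (smooth_at_differentiable (Hf c cp)).
- exact: diff_derivable (smooth_at_differentiable (Hg c cp)).
Qed.

Lemma cderive_sum (I : finType) (P : pred I) c u (f : I -> M ->
  R) p : around c p ->
  (forall i, fsmooth (f i) p) ->
  cderive c u (fun q => \sum_(i | P i) f i q) p = \sum_(i | P i) cderive c u (f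
    i) p.
Proof.
move=> cp Hf; elim: (index_enum I) => [|i r IH].
  rewrite big_nil -[RHS](cderive_cst c u 0 p); congr cderive; apply/funext => q.
  by rewrite big_nil.
have E : (fun q => \sum_(j <- i :: r | P j) f j q) =
    if P i then fun q => f i q + \sum_(j <- r | P j) f j q
    else fun q => \sum_(j <- r | P j) f j q.
  by apply/funext => q; rewrite big_cons; case: ifP.
rewrite E big_cons; case: ifP => // _; rewrite cderiveD ?IH//.
exact: fsmooth_sum.
Qed.

Lemma cderive_dir_sum c u f p : around c p -> fsmooth f p ->
  cderive c u f p = \sum_i u 0 i * cderive c (delta_mx 0 i) f p.
Proof.
move=> cp Hf; have df := smooth_at_differentiable (Hf c cp).
rewrite cderiveE deriveE// {1}(row_sum_delta u) linear_sum;
  apply: eq_bigr => i _.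
by rewrite linearZ /= cderiveE deriveE.
Qed.

Lemma cderive_comm c u v f p : around c p -> fsmooth f p ->
  cderive c u (cderive c v f) p = cderive c v (cderive c u f) p.
Proof.
move=> cp Hf; rewrite cderiveE [RHS]cderiveE.
rewrite (near_eq_derive u (cderive_near v f cp)) (near_eq_derive v
  (cderive_near u f cp)).
exact: derive_comm (Hf c cp).
Qed.

(** The Jacobian matrix from the coordinates of [c] to those of [c'], acting on
    row vectors. *)
Fact transition_mx_sealed : {F : chart R n M -> chart R n M -> M -> 'M[R]_n |
  forall c c' p, F c c' p = lin1_mx ('d (c' \o icoord c) (c p))}.
Proof. by exists (fun c c' p => lin1_mx ('d (c' \o icoord c) (c p))). Qed.

Definition transition_mx := sval transition_mx_sealed.

Lemma transition_mxE c c' p : transition_mx c c' p = lin1_mx ('d (c' \o icoord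
  c) (c p)).
Proof. exact: svalP transition_mx_sealed c c' p. Qed.

Lemma differentiable_transition c c' p : around c p -> around c' p ->
  differentiable (c' \o icoord c) (c p).
Proof.
move=> cp c'p; apply: differentiable_rV => j.
exact: smooth_at_differentiable (smooth_at_transition j cp c'p).
Qed.

Lemma transition_mx_cderive c c' p i j : around c p -> around c' p ->
  transition_mx c c' p i j = cderive c (delta_mx 0 i) (fun q => c' q 0 j) p.
Proof.
move=> cp c'p; have dt := differentiable_transition cp c'p.
by rewrite transition_mxE mxE cderiveE -deriveE// derive_coord//;
  exact: diff_derivable.
Qed.

Lemma cderive_chain c c' u f p : around c p -> around c' p -> fsmooth f p ->
  cderive c u f p = cderive c' (u *m transition_mx c c' p) f p.
Proof.
move=> cp c'p Hf; have [_ dc] := cp.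
have dt := differentiable_transition cp c'p.
have df : differentiable (f \o icoord c') ((c' \o icoord c) (c p)).
  by rewrite /= coordK//; exact: smooth_at_differentiable (Hf c' c'p).
rewrite !cderiveE -(near_eq_derive u (near_transition f cp c'p)).
rewrite [LHS](@deriveE _ _ _ ((f \o icoord c') \o (c' \o icoord c)));
  last first.
  exact: differentiable_comp.
rewrite diff_comp//= transition_mxE mul_rV_lin1 coordK// deriveE//.
exact: smooth_at_differentiable (Hf c' c'p).
Qed.

Lemma to_chartE c p v : to_chart c p v = v *m transition_mx (chart_at p) c p.
Proof. by rewrite transition_mxE mul_rV_lin1. Qed.

Lemma of_chartE c p v : of_chart c p v = v *m transition_mx c (chart_at p) p.
Proof. by rewrite transition_mxE mul_rV_lin1. Qed.

Lemma transition_mx_cocycle c c' c'' p : around c p -> around c' p ->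
  around c'' p ->
  transition_mx c c' p *m transition_mx c' c'' p = transition_mx c c'' p.
Proof.
move=> cp c'p c''p; apply/matrixP => i j.
rewrite [LHS]mxE [RHS]transition_mx_cderive// (cderive_chain _ cp c'p
  (fsmooth_coord j c''p)).
rewrite (cderive_dir_sum _ c'p (fsmooth_coord j c''p)); apply: eq_bigr => k _.
rewrite [X in _ * X](transition_mx_cderive k j c'p c''p);
  apply: (congr1 ( *%R^~ _)).
by have /rowP/(_ k) := rowE i (transition_mx c c' p); rewrite [LHS]mxE => ->.
Qed.

Lemma transition_mx_id c p : around c p -> transition_mx c c p = 1%:M.
Proof.
move=> cp; apply/matrixP => i j; rewrite transition_mx_cderive// cderiveE.
have E : \forall y \near c p, ((fun q => c q 0 j) \o icoord c) y = y 0 j.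
  by apply: filterS (near_cod cp) => y cy /=; rewrite icoordK.
rewrite (near_eq_derive _ E).
have := derive_coord (@derivable_id _ 'rV[R]_n (c p) (delta_mx 0 i)) j.
by rewrite derive_id => /esym; rewrite /= => ->; rewrite !mxE eqxx eq_sym.
Qed.

Lemma transition_mx_inv c c' p : around c p -> around c' p ->
  transition_mx c c' p *m transition_mx c' c p = 1%:M.
Proof. by move=> cp c'p; rewrite transition_mx_cocycle// transition_mx_id. Qed.

Lemma transition_mx_unit c c' p : around c p -> around c' p ->
  transition_mx c c' p \in unitmx.
Proof. by move=> cp c'p; have [] := mulmx1_unit (transition_mx_inv cp c'p). Qed.

Lemma fsmooth_transition c c' p i j : around c p -> around c' p ->
  fsmooth (fun q => transition_mx c c' q i j) p.
Proof.
move=> cp c'p; apply: fsmooth_congr (fsmooth_cderive (delta_mx 0 i) cp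
  (fsmooth_coord j c'p)).
by apply: filterS2 (near_around cp) (near_around c'p) => q cq c'q;
  rewrite transition_mx_cderive.
Qed.

End ChartCalculus.
Arguments fsmooth_cst {R n M} a p.

(** * Matrix-valued functions on the manifold *)
Section MatrixFields.
Context {R : realType} {n : nat} {M : smooth_manifold R n}.
Implicit Types (c : chart R n M) (p q : M) (u v : 'rV[R]_n).

Definition mxsmooth k l (F : M -> 'M[R]_(k, l)) p :=
  forall i j, fsmooth (fun q => F q i j) p.

Definition mxcderive k l c u (F : M -> 'M[R]_(k, l)) p : 'M[R]_(k, l) :=
  \matrix_(i, j) cderive c u (fun q => F q i j) p.

Lemma mxsmooth_congr k l (F G : M -> 'M[R]_(k, l)) p :
  (\forall q \near p, F q = G q) -> mxsmooth F p -> mxsmooth G p.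
Proof.
by move=> FG HF i j; apply: fsmooth_congr (HF i j); apply: filterS FG => q ->.
Qed.

Lemma mxsmooth_cst k l (A : 'M[R]_(k, l)) p : mxsmooth (fun=> A) p.
Proof. by move=> i j; exact: fsmooth_cst. Qed.

Lemma mxsmoothD k l (F G : M -> 'M[R]_(k, l)) p :
  mxsmooth F p -> mxsmooth G p -> mxsmooth (fun q => F q + G q) p.
Proof.
move=> HF HG i j; apply: fsmooth_congr (fsmoothD (HF i j) (HG i j)).
by apply: filterE => q; rewrite mxE.
Qed.

Lemma mxsmoothN k l (F : M -> 'M[R]_(k, l)) p : mxsmooth F p ->
  mxsmooth (fun q => - F q) p.
Proof.
move=> HF i j; apply: fsmooth_congr (fsmoothN (HF i j)).
by apply: filterE => q; rewrite mxE.
Qed.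

Lemma mxsmoothB k l (F G : M -> 'M[R]_(k, l)) p :
  mxsmooth F p -> mxsmooth G p -> mxsmooth (fun q => F q - G q) p.
Proof. by move=> HF HG; exact: mxsmoothD HF (mxsmoothN HG). Qed.

Lemma mxsmoothM k l m (F : M -> 'M[R]_(k, l)) (G : M -> 'M[R]_(l, m)) p :
  mxsmooth F p -> mxsmooth G p -> mxsmooth (fun q => F q *m G q) p.
Proof.
move=> HF HG i j.
apply: (@fsmooth_congr _ _ _ (fun q => \sum_k F q i k * G q k j)).
  by apply: filterE => q; rewrite mxE.
by apply: fsmooth_sum => x _; exact: fsmoothM.
Qed.

Lemma mxsmoothZ k l (f : M -> R) (F : M -> 'M[R]_(k, l)) p :
  fsmooth f p -> mxsmooth F p -> mxsmooth (fun q => f q *: F q) p.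
Proof.
move=> Hf HF i j; apply: fsmooth_congr (fsmoothM Hf (HF i j)).
by apply: filterE => q; rewrite mxE.
Qed.

Lemma mxsmoothT k l (F : M -> 'M[R]_(k, l)) p : mxsmooth F p ->
  mxsmooth (fun q => (F q)^T) p.
Proof.
move=> HF i j; apply: fsmooth_congr (HF j i).
by apply: filterE => q; rewrite mxE.
Qed.

Lemma mxsmooth_sum (I : Type) (r : seq I) (P : pred I) k l (F : I -> M ->
  'M[R]_(k, l)) p :
  (forall i, P i -> mxsmooth (F i) p) -> mxsmooth (fun q => \sum_(i <- r | P i)
    F i q) p.
Proof.
move=> HF i j; apply: (@fsmooth_congr _ _ _ (fun q => \sum_(x <- r | P x) F x q
  i j)).
  by apply: filterE => q; rewrite summxE.
by apply: fsmooth_sum => x Px; exact: HF.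
Qed.

Lemma fsmooth_det k (F : M -> 'M[R]_k) p : mxsmooth F p ->
  fsmooth (fun q => \det (F q)) p.
Proof.
move=> HF; apply: fsmooth_sum => s _; apply: fsmoothM (fsmooth_cst _ _) _.
by apply: fsmooth_prod => i _; exact: HF.
Qed.

Lemma near_unitmx k (F : M -> 'M[R]_k) p : F p \in unitmx -> mxsmooth F p ->
  \forall q \near p, F q \in unitmx.
Proof.
rewrite unitmxE unitfE => Fp /fsmooth_det Hd.
have cp := around_chart_at p; have [_ dc] := cp.
have cd := differentiable_continuous (smooth_at_differentiable (Hd _ cp)).
have : \forall y \near chart_at p p,
    (fun q => \det (F q)) (icoord (chart_at p) y) != 0.
  by apply: (cvgr_neq0 _ cd); rewrite /= coordK.
move=> /(near_coord cp); apply: filterS2 (near_around cp) => q [_ dq].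
by rewrite coordK// unitmxE unitfE.
Qed.

(** By Cramer's rule. *)
Lemma mxsmooth_inv k (F : M -> 'M[R]_k) p : F p \in unitmx -> mxsmooth F p ->
  mxsmooth (fun q => invmx (F q)) p.
Proof.
move=> Fp HF i j.
apply: (@fsmooth_congr _ _ _ (fun q => (\det (F q))^-1 * cofactor (F q) j i)).
  apply: filterS (near_unitmx Fp HF) => q Fq; rewrite /invmx Fq.
  by rewrite !mxE.
apply: fsmoothM; first by apply: fsmoothV;
  [rewrite -unitfE -unitmxE|exact: fsmooth_det].
apply: fsmoothM (fsmooth_cst _ _) _; apply: fsmooth_det => x y.
apply: fsmooth_congr (HF (lift j x) (lift i y)).
by apply: filterE => q; rewrite !mxE.
Qed.

Lemma mxsmooth_transition c c' p : around c p -> around c' p ->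
  mxsmooth (transition_mx c c') p.
Proof. by move=> cp c'p i j; exact: fsmooth_transition. Qed.

Lemma mxsmooth_mxcderive k l c u (F : M -> 'M[R]_(k, l)) p :
  around c p -> mxsmooth F p -> mxsmooth (mxcderive c u F) p.
Proof.
move=> cp HF i j; apply: fsmooth_congr (fsmooth_cderive u cp (HF i j)).
by apply: filterE => q; rewrite mxE.
Qed.

Lemma mxcderive_congr k l c u (F G : M -> 'M[R]_(k, l)) p : around c p ->
  (\forall q \near p, F q = G q) -> mxcderive c u F p = mxcderive c u G p.
Proof.
move=> cp FG; apply/matrixP => i j; rewrite !mxE; apply: cderive_congr => //.
by apply: filterS FG => q ->.
Qed.

Lemma mxcderive_cst k l c u (A : 'M[R]_(k, l)) p :
  mxcderive c u (fun=> A) p = 0.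
Proof. by apply/matrixP => i j; rewrite !mxE cderive_cst. Qed.

Lemma mxcderiveD k l c u (F G : M -> 'M[R]_(k, l)) p : around c p ->
  mxsmooth F p -> mxsmooth G p -> mxcderive c u (fun q => F q + G q) p =
    mxcderive c u F p + mxcderive c u G p.
Proof.
move=> cp HF HG; apply/matrixP => i j; rewrite !mxE -cderiveD//.
by congr cderive; apply/funext => q; rewrite mxE.
Qed.

Lemma mxcderiveM k l m c u (F : M -> 'M[R]_(k, l)) (G : M -> 'M[R]_(l, m)) p :
  around c p -> mxsmooth F p -> mxsmooth G p ->
  mxcderive c u (fun q => F q *m G q) p = mxcderive c u F p *m G p + F p *m
    mxcderive c u G p.
Proof.
move=> cp HF HG; apply/matrixP => i j; rewrite !mxE -big_split /=.
transitivity (cderive c u (fun q => \sum_x F q i x * G q x j) p).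
  by congr cderive; apply/funext => q; rewrite mxE.
rewrite cderive_sum// => [|x]; last exact: fsmoothM.
by apply: eq_bigr => x _; rewrite cderiveM// !mxE.
Qed.

Lemma mxcderiveZ k l c u (f : M -> R) (F : M -> 'M[R]_(k, l)) p : around c p ->
  fsmooth f p -> mxsmooth F p ->
  mxcderive c u (fun q => f q *: F q) p = cderive c u f p *: F p + f p *:
    mxcderive c u F p.
Proof.
move=> cp Hf HF; apply/matrixP => i j; rewrite !mxE -cderiveM//.
by congr cderive; apply/funext => q; rewrite mxE.
Qed.

Lemma mxcderiveT k l c u (F : M -> 'M[R]_(k, l)) p :
  mxcderive c u (fun q => (F q)^T) p = (mxcderive c u F p)^T.
Proof.
apply/matrixP => i j; rewrite !mxE.
by congr cderive; apply/funext => q; rewrite mxE.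
Qed.

Lemma mxcderive_dir_sum k l c u (F : M -> 'M[R]_(k, l)) p : around c p ->
  mxsmooth F p ->
  mxcderive c u F p = \sum_i u 0 i *: mxcderive c (delta_mx 0 i) F p.
Proof.
move=> cp HF; apply/matrixP => i j; rewrite summxE mxE cderive_dir_sum//.
by apply: eq_bigr => x _; rewrite !mxE.
Qed.

Lemma mxcderive_chain k l c c' u (F : M -> 'M[R]_(k, l)) p : around c p ->
  around c' p -> mxsmooth F p -> mxcderive c u F p = mxcderive c' (u *m
    transition_mx c c' p) F p.
Proof. by move=> cp c'p HF; apply/matrixP => i j; rewrite !mxE;
  exact: cderive_chain. Qed.

End MatrixFields.
Arguments mxsmooth_cst {R n M k l} A p.

(** * Components of tensor fields in a chart *)
Section Components.
Context {R : realType} {n : nat} {M : smooth_manifold R n}.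
Implicit Types (c : chart R n M) (p q : M) (u v : 'rV[R]_n).
Implicit Types (X Y : M -> 'rV[R]_n) (B T : M -> 'M[R]_n).

Local Notation at_ := chart_at.

(** Components in the chart [c] of a vector field, of a bilinear form ([bcomp])
    and of an endomorphism ([ecomp]). *)
Definition vcomp c X q : 'rV[R]_n := X q *m transition_mx (at_ q) c q.

Definition bcomp c B q : 'M[R]_n := transition_mx c (at_ q) q *m B q *m
  (transition_mx c (at_ q) q)^T.

Definition ecomp c T q : 'M[R]_n := transition_mx c (at_ q) q *m T q *m
  transition_mx (at_ q) c q.

Lemma transition_mx_atl c p : around c p ->
  transition_mx (at_ p) c p *m transition_mx c (at_ p) p = 1%:M.
Proof. by move=> cp; apply: transition_mx_inv => //; exact: around_chart_at.
  Qed.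

Lemma transition_mx_atr c p : around c p ->
  transition_mx c (at_ p) p *m transition_mx (at_ p) c p = 1%:M.
Proof. by move=> cp; apply: transition_mx_inv => //; exact: around_chart_at.
  Qed.

Lemma vcompK c X p : around c p -> vcomp c X p *m transition_mx c (at_ p) p = X
  p.
Proof. by move=> cp; rewrite /vcomp -mulmxA transition_mx_atl// mulmx1. Qed.

Lemma vcomp_at X p : vcomp (at_ p) X p = X p.
Proof. by rewrite /vcomp transition_mx_id ?mulmx1//; exact: around_chart_at.
  Qed.

Lemma vcomp_change c c' X p : around c p -> around c' p ->
  vcomp c' X p = vcomp c X p *m transition_mx c c' p.
Proof.
move=> cp c'p; rewrite /vcomp -mulmxA transition_mx_cocycle//;
  exact: around_chart_at.
Qed.

Lemma bcompE c B p u v :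
  (u *m bcomp c B p *m v^T) 0 0 =
  bil (B p) (u *m transition_mx c (at_ p) p) (v *m transition_mx c (at_ p) p).
Proof. by rewrite /bil /bcomp trmx_mul !mulmxA. Qed.

Lemma bil_bcomp c B X Y p : around c p ->
  bil (B p) (X p) (Y p) = (vcomp c X p *m bcomp c B p *m (vcomp c Y p)^T) 0 0.
Proof. by move=> cp; rewrite bcompE !vcompK. Qed.

Lemma vcomp_endo c T X p : around c p ->
  vcomp c (endo_field T X) p = vcomp c X p *m ecomp c T p.
Proof.
move=> cp; rewrite /vcomp /ecomp /endo_field -!mulmxA.
by rewrite (mulmxA (transition_mx (at_ p) c p)) transition_mx_atl// mul1mx.
Qed.

Lemma mxsmooth_vcomp_change c c' X p : around c p -> around c' p ->
  mxsmooth (vcomp c X) p -> mxsmooth (vcomp c' X) p.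
Proof.
move=> cp c'p HX; apply: (mxsmooth_congr _ (mxsmoothM HX (mxsmooth_transition
  cp c'p))).
by apply: filterS2 (near_around cp) (near_around c'p) => q cq c'q;
  rewrite -vcomp_change.
Qed.

Lemma around_icoord c x : atlas c -> cod c x -> around c (icoord c x).
Proof. by move=> ac cx; split=> //; exact: icoord_dom. Qed.

Lemma nbhs_cod c p : around c p -> nbhs (c p) (cod c).
Proof. by move=> cp; exact: near_cod. Qed.

Lemma smooth_funP (f : M -> R) : smooth_fun f <-> forall p, fsmooth f p.
Proof.
split=> [Hf p c cp|Hf c ac].
  by have [ac dc] := cp; exact: smooth_on_smooth_at (Hf c ac) (nbhs_cod cp).
apply: smooth_at_smooth_on => x cx; have :=
  Hf (icoord c x) c (around_icoord ac cx).
by rewrite icoordK.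
Qed.

Lemma smooth_vfieldP X :
  smooth_vfield X <-> forall p c, around c p -> mxsmooth (vcomp c X) p.
Proof.
have E c : local_rep c X = vcomp c X \o icoord c.
  by apply/funext => x; rewrite /local_rep to_chartE.
split=> [HX p c cp i j|HX c ac].
  apply: (fsmooth_chart cp); have [ac dc] := cp.
  apply: smooth_at_congr (smooth_on_smooth_at_rV j (HX c ac) (nbhs_cod cp)).
  by apply: filterE => x; rewrite E ord1.
apply: smooth_at_smooth_on_rV => x j cx.
have cp := around_icoord ac cx.
have := HX _ _ cp 0 j c cp; rewrite icoordK//.
by apply: smooth_at_congr; apply: filterE => y /=; rewrite E.
Qed.

Lemma smooth_bilP B :
  smooth_bil B <-> forall p c, around c p -> mxsmooth (bcomp c B) p.
Proof.
have E c u v p : bil (B p) (of_chart c p u) (of_chart c p v) =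
    (u *m bcomp c B p *m v^T) 0 0 by rewrite bcompE !of_chartE.
split=> [HB p c cp i j|HB c ac u v].
  apply: (fsmooth_chart cp); have [ac dc] := cp.
  have := smooth_on_smooth_at (HB c ac (delta_mx 0 i) (delta_mx 0 j)) (nbhs_cod
    cp).
  apply: smooth_at_congr; apply: filterE => x /=; rewrite E.
  by rewrite -rowE trmx_delta -colE [col _ _ _ _]mxE [row _ _ _ _]mxE.
apply: smooth_at_smooth_on => x cx; have cp := around_icoord ac cx.
have := mxsmoothM (mxsmoothM (mxsmooth_cst u _) (HB _ _ cp)) (mxsmooth_cst v^T
  _).
move=> /(_ 0 0 c cp); rewrite icoordK//.
by apply: smooth_at_congr; apply: filterE => y /=; rewrite E.
Qed.

Lemma smooth_endoP T :
  smooth_endo T <-> forall p c, around c p -> mxsmooth (ecomp c T) p.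
Proof.
have E c u p : to_chart c p (of_chart c p u *m T p) = u *m ecomp c T p.
  by rewrite to_chartE of_chartE /ecomp !mulmxA.
split=> [HT p c cp i j|HT c ac u].
  apply: (fsmooth_chart cp); have [ac dc] := cp.
  have := smooth_on_smooth_at_rV j (HT c ac (delta_mx 0 i)) (nbhs_cod cp).
  by apply: smooth_at_congr; apply: filterE => x /=;
    rewrite E -rowE [row _ _ _ _]mxE.
apply: smooth_at_smooth_on_rV => x j cx; have cp := around_icoord ac cx.
have := mxsmoothM (mxsmooth_cst u _) (HT _ _ cp).
move=> /(_ 0 j c cp); rewrite icoordK//.
by apply: smooth_at_congr; apply: filterE => y /=; rewrite E.
Qed.

Lemma lie_funE c X f p : around c p -> fsmooth f p ->
  lie_fun X f p = cderive c (vcomp c X p) f p.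
Proof.
move=> cp Hf; have ap := around_chart_at p.
by rewrite /lie_fun -cderiveE (cderive_chain _ ap cp Hf).
Qed.

Lemma derive_local_rep c Y p u : around c p -> mxsmooth (vcomp c Y) p ->
  'D_u (local_rep c Y) (c p) = mxcderive c u (vcomp c Y) p.
Proof.
move=> cp HY; have E : local_rep c Y = vcomp c Y \o icoord c.
  by apply/funext => x; rewrite /local_rep to_chartE.
have dY : differentiable (local_rep c Y) (c p).
  rewrite E; apply: differentiable_rV => j.
  exact: smooth_at_differentiable (HY 0 j c cp).
have dYu : derivable (local_rep c Y) (c p) u by exact: diff_derivable.
rewrite (derive_mx dYu); apply/matrixP => i j.
by rewrite !mxE cderiveE E.
Qed.

(** The bracket is defined through one chosen chart at each point.  Changing
    the chart adds a second derivative of the transition map, which is symmetric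
    and cancels in the difference. *)
Lemma vcomp_bracket c X Y p : around c p ->
  mxsmooth (vcomp c X) p -> mxsmooth (vcomp c Y) p ->
  vcomp c (lie_bracket X Y) p =
  mxcderive c (vcomp c X p) (vcomp c Y) p - mxcderive c (vcomp c Y p) (vcomp c
    X) p.
Proof.
move=> cp HX HY; set a := at_ p; have ap : around a p := around_chart_at p.
have HXa := mxsmooth_vcomp_change cp ap HX;
  have HYa := mxsmooth_vcomp_change cp ap HY.
have HJ := mxsmooth_transition ap cp.
have chg Z W : mxsmooth (vcomp a Z) p -> mxsmooth (vcomp c Z) p ->
    mxcderive c (vcomp c W p) (vcomp c Z) p =
    mxcderive a (W p) (vcomp a Z) p *m transition_mx a c p + Z p *m mxcderive a
      (W p) (transition_mx a c) p.
  move=> HZa HZ; rewrite -[Z p]vcomp_at -/a -mxcderiveM//.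
  rewrite [in LHS]/vcomp -mxcderive_chain//; apply: mxcderive_congr => //.
  by apply: filterS2 (near_around cp) (near_around ap) => q cq aq;
    rewrite -vcomp_change.
rewrite !chg// opprD addrACA -mulmxBl.
have -> : Y p *m mxcderive a (X p) (transition_mx a c) p = X p *m mxcderive a
  (Y p) (transition_mx a c) p.
  have key u v : u *m mxcderive a v (transition_mx a c) p =
      \row_j cderive a v (cderive a u (fun q => c q 0 j)) p.
    apply/rowP => j; rewrite !mxE.
    have E : \forall q \near p, cderive a u (fun q => c q 0 j) q =
        \sum_i u 0 i * transition_mx a c q i j.
      apply: filterS2 (near_around cp) (near_around ap) => q cq aq.
      rewrite (cderive_dir_sum _ aq (fsmooth_coord j cq));
        apply: eq_bigr => i _.
      by rewrite transition_mx_cderive.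
    rewrite (cderive_congr v ap E) cderive_sum// => [|i];
      last exact: fsmoothM (fsmooth_cst _ _) (HJ i j).
    apply: eq_bigr => i _; rewrite cderiveM//; last exact: fsmooth_cst.
    by rewrite cderive_cst mul0r add0r mxE.
  rewrite !key; apply/rowP => j; rewrite !mxE; apply: cderive_comm => //.
  exact: fsmooth_coord.
rewrite subrr addr0 {1}/vcomp; congr (_ *m _).
by rewrite /lie_bracket !derive_local_rep.
Qed.

End Components.

(** * Partitions of unity *)
Section PartitionOfUnity.
Context {R : realType} {n : nat} {M : smooth_manifold R n}.
Implicit Types (c : chart R n M) (p q : M).

(** Extend a Euclidean bump by 0.  The result is smooth because the bump is
    supported in a compact subset of the chart, which is closed in the whole
    manifold as the latter is Hausdorff. *)
Lemma bump_manifold p (O : M -> Prop) : (\forall q \near p, O q) ->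
  exists b : M -> R, [/\ forall q, fsmooth b q, forall q, 0 <= b q <= 1,
    \forall q \near p, b q = 1 &
    forall q, (\forall z \near q, b z = 0) \/ O q].
Proof.
move=> HO; have := around_chart_at p; set a := chart_at p => ap.
have [r0 /= r0_gt0 Hr0] : nbhs_ball (a p) [set y | cod a y /\ O (icoord a y)].
  by apply/nbhs_ballP; exact: filterI (near_cod ap) (near_icoord ap HO).
pose r := r0 / 2.
have r_gt0 : 0 < r by rewrite divr_gt0.
have [rho [sm_rho rho01 rho1 rho0]] := bump_rV (a p) r_gt0.
pose K := closed_ball (a p) r.
have KE y : K y <-> `|a p - y| <= r by rewrite /K closed_ballE.
have KS y : K y -> cod a y /\ O (icoord a y).
  move=> /KE yr; apply: Hr0; rewrite -ball_normE /=.
  by apply: le_lt_trans yr _; rewrite ltr_pdivrMr// ltr_pMr// ltr1n.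
have cK : compact K.
  apply: bounded_closed_compact; last exact: closed_ball_closed.
  exists (`|a p| + r); split; first exact: num_real.
  move=> x xr y /KE yr; apply: le_trans (ltW xr).
  rewrite -[y](subKr (a p)) (le_trans (ler_normB _ _))//.
  by rewrite lerD2l.
have clK : closed (icoord a @` K).
  apply: (compact_closed (@manifold_hausdorff _ _ M)).
  apply: continuous_compact cK; apply: continuous_in_subspaceT => y.
  by rewrite inE => /KS[cy _]; exact: icoord_continuous.
pose b q := if pselect (Defs.dom a q) then rho (a q) else 0.
have bE q : around a q -> \forall z \near q, b z = rho (a z).
  move=> aq; apply: filterS (near_around aq) => z [_ dz].
  by rewrite /b; case: pselect.
have b0 q : ~ (icoord a @` K) q -> b q = 0.
  move=> nKq; rewrite /b; case: pselect => // dq.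
  apply: rho0; rewrite ltNge; apply/negP => qr; apply: nKq.
  by exists (a q); [apply/KE; rewrite distrC|rewrite coordK].
have b0' q : ~ (icoord a @` K) q -> \forall z \near q, b z = 0.
  move=> nKq; have : \forall z \near q, (~` (icoord a @` K)) z.
    by apply: open_nbhs_nbhs; split=> //; exact: closed_openC.
  by apply: filterS => z /b0.
exists b; split.
- move=> q; have [[y Ky <-]|nKq] := pselect ((icoord a @` K) q).
    have [cy _] := KS _ Ky.
    have aq : around a (icoord a y) by apply: around_icoord => //; case: ap.
    apply: (@fsmooth_congr _ _ _ (rho \o a)).
      by apply: filterS (bE _ aq) => z ->.
    apply: (fsmooth_chart aq); apply: smooth_at_congr (sm_rho _).
    by apply: filterS (near_cod aq) => z cz /=; rewrite icoordK.
  apply: fsmooth_congr (fsmooth_cst 0 q).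
  by apply: filterS (b0' _ nKq) => z ->.
- by move=> q; rewrite /b; case: (pselect _) => d; rewrite ?rho01// lexx ler01.
- have rho1' := @near_coord _ _ _ _ _ (fun y => rho y = 1) ap rho1.
  by apply: filterS2 (bE _ ap) rho1' => q -> ->.
- move=> q; have [[y Ky <-]|nKq] := pselect ((icoord a @` K) q).
    by right; have [] := KS _ Ky.
  by left; exact: b0'.
Qed.

(** Used to test tensor identities at a point against global fields with
    constant components near it. *)
Lemma extend_vector c p u : around c p ->
  exists2 X : M -> 'rV[R]_n, smooth_vfield X & \forall q \near p,
    vcomp c X q = u.
Proof.
move=> cp; have [b [sb _ b1 b0]] := bump_manifold (near_around cp).
pose X q := b q *: (u *m transition_mx c (chart_at q) q).
have XE q : around c q -> vcomp c X q = b q *: u.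
  by move=> cq; rewrite /vcomp -scalemxAl -mulmxA transition_mx_atr// mulmx1.
exists X; last first.
  by apply: filterS2 (near_around cp) b1 => q cq bq; rewrite XE// bq scale1r.
apply/smooth_vfieldP => q c' c'q; case: (b0 q) => [bq|cq].
  apply: mxsmooth_congr (mxsmooth_cst 0 q); apply: filterS bq => z bz.
  by rewrite /vcomp /X bz scale0r mul0mx.
apply: (mxsmooth_vcomp_change cq c'q); apply:
  mxsmooth_congr (mxsmoothZ (sb q) (mxsmooth_cst u q)).
by apply: filterS (near_around cq) => z cz; rewrite XE.
Qed.

(** The functions are [b i * \prod_(j < i) (1 - b j)] for countably many bumps
    [b i] such that every point has a neighbourhood where some [b i] is 1.  On
    it all the later functions vanish, so the family is locally
    finite, and the partial sums telescope to
    [1 - \prod_(j < i) (1 - b j)]. *)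
Lemma partition_of_unity (p0 : M) (O : M -> M -> Prop) :
  (forall p, \forall q \near p, O p q) ->
  exists (P : nat -> M) (chi : nat -> M -> R) (N : M -> nat),
  [/\ forall i q, fsmooth (chi i) q, forall i q, 0 <= chi i q,
      forall i q, (\forall z \near q, chi i z = 0) \/ O (P i) q &
      forall q, \forall z \near q, (forall i, (N q <= i)%N -> chi i z = 0) /\
        \sum_(i < N q) chi i z = 1].
Proof.
move=> HO; have [b Hb] := choice (fun p => bump_manifold (HO p)).
have [Bs /countable_injP[k kinj] [Bopen Bnbhs]] :=
  @manifold_second_countable _ _ M.
pose good i p := exists U, [/\ Bs U, k U = i & U `<=` [set q | b p q = 1]].
pose P i := if pselect (exists p, good i p) is left H then sval (cid H) else p0.
have PP i p : good i p -> good i (P i).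
  by move=> gp; rewrite /P; case: pselect => [H|[]]; [case: cid|exists p].
have idx q : exists i, \forall z \near q, b (P i) z = 1.
  have [_ _ b1 _] := Hb q.
  have [U [BU Uq] Ub] := Bnbhs q _ b1.
  exists (k U); have gq : good (k U) q by exists U.
  (* [k] is injective on the basis, so its value identifies the open set. *)
  have [U' [BU' kU U'b]] := PP _ _ gq.
  have UU' : U' = U by apply: kinj; rewrite ?inE.
  rewrite UU' in U'b; apply: filterS U'b _; apply: open_nbhs_nbhs.
  by split=> //; exact: Bopen.
have [m Hm] := choice idx.
pose be i := b (P i).
pose chi i q := be i q * \prod_(j < i) (1 - be j q).
have sumchi j q : \sum_(i < j) chi i q = 1 - \prod_(i < j) (1 - be i q).
  elim: j => [|j IH]; first by rewrite !big_ord0 subrr.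
  by rewrite !big_ord_recr /= IH /chi; ring.
have sbe i q : fsmooth (be i) q by have [] := Hb (P i).
have be01 i q : 0 <= be i q <= 1 by have [_ H _ _] := Hb (P i); exact: H.
exists P, chi, (fun q => (m q).+1); split.
- move=> i q; apply: fsmoothM => //; apply: fsmooth_prod => j _.
  exact: fsmoothB (fsmooth_cst _ _) (sbe _ _).
- move=> i q; have /andP[b0 _] := be01 i q; rewrite mulr_ge0//.
  by apply: prodr_ge0 => j _; have /andP[_ b1] := be01 j q; rewrite subr_ge0.
- move=> i q; have [_ _ _ H] := Hb (P i); case: (H q) => [b0|]; last by right.
  by left; apply: filterS b0 => z bz; rewrite /chi /be bz mul0r.
- move=> q; apply: filterS (Hm q) => z bz; split=> [i mi|].
    rewrite /chi (bigD1 (Ordinal mi))//= /be bz subrr mul0r mulr0 //.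
  by rewrite sumchi big_ord_recr /= /be bz subrr mulr0 subr0.
Qed.

End PartitionOfUnity.

(** * Connections on a chart domain *)
Section LocalConnection.
Context {R : realType} {n : nat} {M : smooth_manifold R n}.
Implicit Types (c : chart R n M) (p q : M) (X Y Z : M -> 'rV[R]_n).
Implicit Types (B : M -> 'M[R]_n) (G : M -> 'I_n -> 'M[R]_n).

Local Notation e_ i := (delta_mx 0 i : 'rV[R]_n).

Definition chart_nabla_comp c G X Y q : 'rV[R]_n :=
  mxcderive c (vcomp c X q) (vcomp c Y) q +
  vcomp c Y q *m \sum_i vcomp c X q 0 i *: G q i.

(** The connection on the domain of [c] with Christoffel matrices [G _ i]: row
    [j] of [G _ i] is the derivative of the [j]th coordinate field along the
    [i]th one. *)
Definition chart_nabla c G X Y q : 'rV[R]_n :=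
  chart_nabla_comp c G X Y q *m transition_mx c (chart_at q) q.

Lemma vcomp_chart_nabla c G X Y q : around c q ->
  vcomp c (chart_nabla c G X Y) q = chart_nabla_comp c G X Y q.
Proof. by move=> cq; rewrite /vcomp /chart_nabla -mulmxA transition_mx_atr//
  mulmx1. Qed.

Lemma vcompD c X Y q : vcomp c (X + Y) q = vcomp c X q + vcomp c Y q.
Proof. by rewrite /vcomp mulmxDl. Qed.

Lemma vcompZ c (f : M -> R) X q :
  vcomp c (fun p => f p *: X p) q = f q *: vcomp c X q.
Proof. by rewrite /vcomp scalemxAl. Qed.

Lemma mxsmooth_chart_nabla c G X Y q : around c q -> smooth_vfield X ->
  smooth_vfield Y ->
  (forall i, mxsmooth (G ^~ i) q) -> mxsmooth (vcomp c (chart_nabla c G X Y)) q.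
Proof.
move=> cq /smooth_vfieldP HX /smooth_vfieldP HY HG.
have sX i : fsmooth (fun z => vcomp c X z 0 i) q by exact: HX.
have sY := HY _ _ cq.
have : mxsmooth (fun z => \sum_i vcomp c X z 0 i *:
  mxcderive c (e_ i) (vcomp c Y) z +
    vcomp c Y z *m \sum_i vcomp c X z 0 i *: G z i) q.
  apply: mxsmoothD.
    by apply: mxsmooth_sum => i _; apply: mxsmoothZ => //;
      exact: mxsmooth_mxcderive.
  by apply: mxsmoothM => //; apply: mxsmooth_sum => i _; apply: mxsmoothZ.
apply: mxsmooth_congr; apply: filterS (near_around cq) => z cz.
by rewrite vcomp_chart_nabla// /chart_nabla_comp -mxcderive_dir_sum//;
  exact: HY.
Qed.

Lemma mxcderive_dirD k l c u v (F : M -> 'M[R]_(k, l)) q : around c q ->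
  mxsmooth F q ->
  mxcderive c (u + v) F q = mxcderive c u F q + mxcderive c v F q.
Proof.
move=> cq HF; rewrite (mxcderive_dir_sum (u + v))// (mxcderive_dir_sum u)//
  (mxcderive_dir_sum v)//.
by rewrite -big_split; apply: eq_bigr => i _; rewrite mxE scalerDl.
Qed.

Lemma mxcderive_dirZ k l c a u (F : M -> 'M[R]_(k, l)) q : around c q ->
  mxsmooth F q ->
  mxcderive c (a *: u) F q = a *: mxcderive c u F q.
Proof.
move=> cq HF; rewrite (mxcderive_dir_sum (a *:
  u))// (mxcderive_dir_sum u)// scaler_sumr.
by apply: eq_bigr => i _; rewrite mxE scalerA.
Qed.

Section ConnectionAxioms.
Variables (c : chart R n M) (G : M -> 'I_n -> 'M[R]_n) (q : M).
Hypothesis cq : around c q.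

Lemma chart_nablaDl X X' Y : smooth_vfield Y ->
  chart_nabla c G (X + X') Y q = chart_nabla c G X Y q + chart_nabla c G X' Y q.
Proof.
move=> /smooth_vfieldP HY; rewrite /chart_nabla -mulmxDl; congr (_ *m _).
rewrite /chart_nabla_comp vcompD (mxcderive_dirD _ _ cq (HY _ _ cq))
  [RHS]addrACA -mulmxDr -big_split.
by congr (_ + _ *m _); apply: eq_bigr => i _; rewrite mxE scalerDl.
Qed.

Lemma chart_nablaZl (f : M -> R) X Y : smooth_vfield Y ->
  chart_nabla c G (fun p => f p *: X p) Y q = f q *: chart_nabla c G X Y q.
Proof.
move=> /smooth_vfieldP HY; rewrite /chart_nabla scalemxAl; congr (_ *m _).
rewrite /chart_nabla_comp vcompZ (mxcderive_dirZ _ _ cq (HY _ _ cq)) scalerDr.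
rewrite [X in _ = _ + X]scalemxAr scaler_sumr.
by congr (_ + _ *m _); apply: eq_bigr => i _; rewrite mxE scalerA.
Qed.

Lemma chart_nablaDr X Y Y' : smooth_vfield Y -> smooth_vfield Y' ->
  chart_nabla c G X (Y + Y') q = chart_nabla c G X Y q + chart_nabla c G X Y' q.
Proof.
move=> /smooth_vfieldP HY /smooth_vfieldP HY'.
rewrite /chart_nabla -mulmxDl; congr (_ *m _);
  rewrite /chart_nabla_comp vcompD mulmxDl addrACA.
rewrite -(mxcderiveD _ cq (HY _ _ cq) (HY' _ _ cq));
  congr (mxcderive _ _ _ _ + _).
by apply/funext => z; rewrite vcompD.
Qed.

Lemma chart_nablaZr (f : M -> R) X Y : smooth_fun f -> smooth_vfield Y ->
  chart_nabla c G X (fun p => f p *: Y p) q =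
  lie_fun X f q *: Y q + f q *: chart_nabla c G X Y q.
Proof.
move=> /smooth_funP Hf /smooth_vfieldP HY.
rewrite (lie_funE X cq (Hf q)) -[Y q](vcompK Y cq) /chart_nabla.
rewrite [X in _ = X + _]scalemxAl [X in _ = _ + X]scalemxAl -mulmxDl.
congr (_ *m _); rewrite /chart_nabla_comp vcompZ scalerDr -scalemxAl addrA.
rewrite -(mxcderiveZ _ cq (Hf q) (HY _ _ cq)); congr (mxcderive _ _ _ _ + _).
by apply/funext => z; rewrite vcompZ.
Qed.

Lemma chart_nabla_torsion X Y : smooth_vfield X -> smooth_vfield Y ->
  (forall i j, row j (G q i) = row i (G q j)) ->
  chart_nabla c G X Y q - chart_nabla c G Y X q = lie_bracket X Y q.
Proof.
move=> /smooth_vfieldP HX /smooth_vfieldP HY sG.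
rewrite -(vcompK (lie_bracket X Y) cq) (vcomp_bracket cq (HX _ _ cq) (HY _ _
  cq)) /chart_nabla -mulmxBl.
congr (_ *m _); rewrite /chart_nabla_comp opprD addrACA.
rewrite [X in _ + X](_ : _ = 0) ?addr0//; apply/eqP; rewrite subr_eq0;
  apply/eqP.
have E u v : u *m (\sum_i v 0 i *: G q i) =
    \sum_i \sum_j (v 0 i * u 0 j) *: row j (G q i).
  rewrite mulmx_sumr; apply: eq_bigr => i _.
  rewrite -scalemxAr mulmx_sum_row scaler_sumr.
  by apply: eq_bigr => j _; rewrite scalerA.
rewrite !E exchange_big /=; apply: eq_bigr => j _; apply: eq_bigr => i _.
by rewrite sG mulrC.
Qed.

(** If the Christoffel matrices [G] and [G'] satisfy the Leibniz rule for the
    components of [B] along coordinate fields, then they satisfy it for all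
    fields.  This serves for the dual connections of the metric, and with
    [G' = G] for the parallelism of the 2-form. *)
Lemma chart_nabla_dual G' B X Y Z : smooth_vfield Y -> smooth_vfield Z ->
  smooth_bil B ->
  (forall i, mxcderive c (e_ i) (bcomp c B) q =
     G q i *m bcomp c B q + bcomp c B q *m (G' q i)^T) ->
  lie_fun X (bil_field B Y Z) q =
  bil (B q) (chart_nabla c G X Y q) (Z q) + bil (B q) (Y q) (chart_nabla c G' X
    Z q).
Proof.
move=> /smooth_vfieldP HY /smooth_vfieldP HZ /smooth_bilP HB DB.
pose F z := vcomp c Y z *m bcomp c B z *m (vcomp c Z z)^T.
have sF : mxsmooth F q by apply: mxsmoothM;
  [apply: mxsmoothM|apply: mxsmoothT]; [exact: HY|exact: HB|exact: HZ].
have FE : \forall z \near q, F z 0 0 = bil_field B Y Z z.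
  by apply: filterS (near_around cq) => z cz;
    rewrite /bil_field (bil_bcomp _ _ _ cz).
rewrite (lie_funE X cq (fsmooth_congr FE (sF 0 0))) -(cderive_congr _ cq FE).
set u := vcomp c X q.
have -> : cderive c u (fun z => F z 0 0) q = mxcderive c u F q 0 0 by rewrite
  mxE.
have [sY [sB sZ]] := (HY _ _ cq, (HB _ _ cq, HZ _ _ cq)).
rewrite mxcderiveM//; [|exact: mxsmoothM|exact: mxsmoothT];
  rewrite mxcderiveM// mxcderiveT.
have -> : mxcderive c u (bcomp c B) q = (\sum_i u 0 i *: G q i) *m bcomp c B q +
    bcomp c B q *m (\sum_i u 0 i *: G' q i)^T.
  rewrite mxcderive_dir_sum// linear_sum mulmx_sumr mulmx_suml -big_split.
  apply: eq_bigr => i _ /=.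
  by rewrite DB scalerDr linearZ /= -scalemxAl -scalemxAr.
rewrite (bil_bcomp B (chart_nabla c G X Y) Z cq) (bil_bcomp B Y (chart_nabla c
  G' X Z) cq).
rewrite !(vcomp_chart_nabla _ _ _ cq) /chart_nabla_comp -/u.
move: (mxcderive c u _ q) (mxcderive c u _ q) (\sum_i _) (\sum_i _) => a d S S'.
move: (vcomp c Y q) (vcomp c Z q) (bcomp c B q) => y z b.
have entryD (E E' : 'M[R]_1) : E 0 0 + E' 0 0 = (E + E') 0 0 by rewrite mxE.
rewrite entryD; congr (fun_of_matrix _ 0 0).
rewrite !(linearD, trmx_mul, mulmxDl, mulmxDr) /= !mulmxA -!addrA.
by rewrite (trmx_mul z) mulmxA [X in _ + (_ + X)]addrC.
Qed.

End ConnectionAxioms.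
End LocalConnection.

(** * Gluing *)
Section Glue.
Context {R : realType} {n : nat} {M : smooth_manifold R n}.
Variables (O : M -> M -> Prop) (P : nat -> M) (chi : nat -> M -> R) (N : M ->
  nat).
Hypotheses (chi_sm : forall i q, fsmooth (chi i) q)
  (chi_supp : forall i q, (\forall z \near q, chi i z = 0) \/ O (P i) q)
  (chi_sum : forall q, \forall z \near q,
     (forall i, (N q <= i)%N -> chi i z = 0) /\ \sum_(i < N q) chi i z = 1).

(** The weighted sum over all [i]: the terms from [N q] on vanish at [q]. *)
Definition glue (V : lmodType R) (F : nat -> M -> V) q : V :=
  \sum_(i < N q) chi i q *: F i q.

(** Both cutoffs, at [z] and at [q], drop only terms that vanish at [z]. *)
Lemma glue_near (V : lmodType R) (F : nat -> M -> V) q :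
  \forall z \near q, glue F z = \sum_(i < N q) chi i z *: F i z.
Proof.
apply: filterS (chi_sum q) => z [zq _]; have [zz _] :=
  nbhs_singleton (chi_sum z).
have trunc m m' : (forall i, (m <= i)%N -> chi i z = 0) -> (m <= m')%N ->
    \sum_(i < m') chi i z *: F i z = \sum_(i < m) chi i z *: F i z.
  move=> H mm; rewrite -!(big_mkord predT (fun i => chi i z *: F i z)).
  rewrite (@big_cat_nat _ _ _ m)//= [X in _ + X]big_nat_cond.
  rewrite [X in _ + X]big1 ?addr0// => i /andP[/andP[mi _] _].
  by rewrite H ?scale0r.
rewrite /glue; have [le|/ltnW le] := leqP (N z) (N q);
  first by rewrite -(trunc _ _ zz le).
by rewrite (trunc _ _ zq le).
Qed.

Lemma chi_eq0 i q : ~ O (P i) q -> chi i q = 0.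
Proof. by move=> nO; case: (chi_supp i q) => // /nbhs_singleton. Qed.

Lemma glue_eq (V : lmodType R) (F G : nat -> M -> V) q :
  (forall i, O (P i) q -> F i q = G i q) -> glue F q = glue G q.
Proof.
move=> FG; apply: eq_bigr => i _.
have [Oi|/chi_eq0 ->] := pselect (O (P i) q); first by rewrite FG.
by rewrite !scale0r.
Qed.

Lemma sum_chi q : \sum_(i < N q) chi i q = 1.
Proof. by have [] := nbhs_singleton (chi_sum q). Qed.

Lemma glue_cst (V : lmodType R) (v : V) q : glue (fun _ _ => v) q = v.
Proof. by rewrite /glue -scaler_suml sum_chi scale1r. Qed.

Lemma glueD (V : lmodType R) (F G : nat -> M -> V) q :
  glue (fun i z => F i z + G i z) q = glue F q + glue G q.
Proof. by rewrite /glue -big_split; apply: eq_bigr => i _; rewrite scalerDr.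
  Qed.

Lemma glue_linear (V W : lmodType R) (f : {linear V -> W}) (F : nat -> M ->
  V) q :
  f (glue F q) = glue (fun i z => f (F i z)) q.
Proof. by rewrite /glue linear_sum; apply: eq_bigr => i _; rewrite linearZ. Qed.

Lemma mxsmooth_glue_term k l (F : nat -> M -> 'M[R]_(k, l)) i q :
  (O (P i) q -> mxsmooth (F i) q) -> mxsmooth (fun z => chi i z *: F i z) q.
Proof.
move=> HF; case: (chi_supp i q) => [c0|/HF]; last exact: mxsmoothZ.
by apply: mxsmooth_congr (mxsmooth_cst 0 q); apply: filterS c0 => z ->;
  rewrite scale0r.
Qed.

Lemma mxsmooth_glue k l (F : nat -> M -> 'M[R]_(k, l)) (F' : M ->
  'M[R]_(k, l)) q :
  (\forall z \near q, F' z = glue F z) ->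
  (forall i, O (P i) q -> mxsmooth (F i) q) -> mxsmooth F' q.
Proof.
move=> FF' HF; have : mxsmooth (fun z => \sum_(i < N q) chi i z *: F i z) q.
  by apply: mxsmooth_sum => i _; apply: mxsmooth_glue_term; exact: HF.
by apply: mxsmooth_congr; apply: filterS2 FF' (glue_near F q) => z -> ->.
Qed.

Lemma vcomp_glue c (X : nat -> M -> 'rV[R]_n) q :
  vcomp c (glue X) q = glue (fun i => vcomp c (X i)) q.
Proof.
rewrite /vcomp /glue mulmx_suml; apply: eq_bigr => i _.
by rewrite scalemxAl.
Qed.

Lemma bcomp_glue c (B : nat -> M -> 'M[R]_n) q :
  bcomp c (glue B) q = glue (fun i => bcomp c (B i)) q.
Proof.
rewrite /bcomp /glue mulmx_sumr mulmx_suml; apply: eq_bigr => i _.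
by rewrite -scalemxAr -scalemxAl.
Qed.

Variables (G : M -> M -> 'I_n -> 'M[R]_n).
Hypothesis O_around : forall p q, O p q -> around (chart_at p) q.
Hypothesis G_sm : forall p q, O p q -> forall i, mxsmooth (G p ^~ i) q.

Definition glued_connection X Y : M -> 'rV[R]_n :=
  glue (fun i => chart_nabla (chart_at (P i)) (G (P i)) X Y).

(** The Leibniz rule for a combination of connections needs weights of sum 1. *)
Lemma connection_glued : connection glued_connection.
Proof.
split.
- move=> X Y HX HY; apply/smooth_vfieldP => q c cq.
  apply: (mxsmooth_glue (F := fun i => vcomp c (chart_nabla (chart_at (P i)) (G
    (P i)) X Y))).
    by apply: filterE => z; rewrite vcomp_glue.
  move=> i Oi; apply: (mxsmooth_vcomp_change (O_around Oi) cq).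
  by apply: mxsmooth_chart_nabla => //; [exact: O_around|exact: G_sm].
- move=> X X' Y HX HX' HY; apply/funext => q.
  rewrite [RHS]/= -[RHS]glueD; apply: glue_eq => i Oi.
  by rewrite chart_nablaDl//; exact: O_around.
- move=> f X Y Hf HX HY; apply/funext => q.
  rewrite [RHS](glue_linear ( *:%R (f q))); apply: glue_eq => i Oi.
  by rewrite chart_nablaZl//; exact: O_around.
- move=> X Y Y' HX HY HY'; apply/funext => q.
  rewrite -[RHS]glueD; apply: glue_eq => i Oi.
  by rewrite chart_nablaDr//; exact: O_around.
- move=> f X Y Hf HX HY; apply/funext => q.
  rewrite -[X in X + _](glue_cst _ q) [X in _ + X](glue_linear ( *:%R (f q)))
    -glueD.
  by apply: glue_eq => i Oi; rewrite chart_nablaZr//; exact: O_around.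
Qed.

Lemma torsion_free_glued :
  (forall p q, O p q -> forall i j, row j (G p q i) = row i (G p q j)) ->
  torsion_free glued_connection.
Proof.
move=> sG X Y HX HY; apply/funext => q.
rewrite -[lie_bracket X Y q](glue_cst _ q); apply/eqP.
rewrite -[_ q]/(glued_connection X Y q - glued_connection Y X q).
rewrite subr_eq -glueD; apply/eqP; apply: glue_eq => i Oi.
by rewrite -(chart_nabla_torsion (O_around Oi) HX HY (sG _ _ Oi)) subrK.
Qed.

Lemma dual_glued (G' : M -> M -> 'I_n -> 'M[R]_n) B X Y Z :
  smooth_bil B -> smooth_vfield Y -> smooth_vfield Z ->
  (forall p q, O p q -> forall i, mxcderive (chart_at p) (delta_mx 0 i) (bcomp
    (chart_at p) B) q =
     G p q i *m bcomp (chart_at p) B q + bcomp (chart_at p) B q *m (G' p q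
       i)^T) ->
  lie_fun X (bil_field B Y Z) =
  bil_field B (glued_connection X Y) Z +
  bil_field B Y (glue (fun i => chart_nabla (chart_at (P i)) (G' (P i)) X Z)).
Proof.
move=> HB HY HZ DB; apply/funext => q.
rewrite -[LHS](@glue_cst R^o _ q).
transitivity (glue (fun i z =>
    bil (B q) (chart_nabla (chart_at (P i)) (G (P i)) X Y z) (Z q) +
    bil (B q) (Y q) (chart_nabla (chart_at (P i)) (G' (P i)) X Z z) : R^o) q).
  by apply: glue_eq => i Oi; apply: chart_nabla_dual => //;
    [exact: O_around|exact: DB].
rewrite glueD; congr (_ + _).
  rewrite /bil_field /bil /glued_connection /glue !mulmx_suml summxE.
  by apply: eq_bigr => i _; rewrite -!scalemxAl [RHS]mxE.
rewrite /bil_field /bil /glue linear_sum mulmx_sumr summxE.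
by apply: eq_bigr => i _; rewrite linearZ -scalemxAr [RHS]mxE.
Qed.

End Glue.

(** * Bilinear forms *)
Section Bilinear.
Context {R : realType} {n : nat}.
Implicit Types (B g : 'M[R]_n) (u v : 'rV[R]_n).

Lemma bilBl B u u' v : bil B (u - u') v = bil B u v - bil B u' v.
Proof. by rewrite /bil !mulmxBl mxE [X in _ + X]mxE. Qed.

Lemma bil_entry B i j : bil B (delta_mx 0 i) (delta_mx 0 j) = B i j.
Proof. by rewrite /bil -rowE trmx_delta -colE !mxE. Qed.

Lemma bil_tr B u v : bil B u v = bil B^T v u.
Proof.
rewrite /bil; have -> : u *m B *m v^T = (v *m B^T *m u^T)^T.
  by rewrite !trmx_mul !trmxK mulmxA.
by rewrite mxE.
Qed.

Lemma bil_mul_endo (T g : 'M[R]_n) u v : bil (T *m g) u v = bil g (u *m T) v.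
Proof. by rewrite /bil !mulmxA. Qed.

Lemma skew_bilP B : (forall u v, bil B u v = - bil B v u) -> B^T = - B.
Proof.
move=> sB; apply/matrixP => i j.
by rewrite [LHS]mxE [RHS]mxE -!bil_entry sB.
Qed.

Lemma posdef_unit g : (forall v, v != 0 -> 0 < bil g v v) -> g \in unitmx.
Proof.
move=> pg; rewrite -row_free_unit -kermx_eq0; apply/eqP/row_matrixP => i.
rewrite row0; apply: contrapT => /eqP/pg.
have -> : bil g (row i (kermx g)) (row i (kermx g)) = 0; last by rewrite ltxx.
rewrite /bil; have /sub_kermxP -> := row_sub i (kermx g).
by rewrite mul0mx mxE.
Qed.

Lemma posdef_inj g u v : (forall v, v != 0 -> 0 < bil g v v) ->
  (forall w, bil g w u = bil g w v) -> u = v.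
Proof.
move=> pg uv; apply/eqP; rewrite -subr_eq0; apply: contrapT => /negP/pg.
have -> : bil g (u - v) (u - v) = bil g (u - v) u - bil g (u - v) v.
  by rewrite /bil linearB mulmxBr mxE [X in _ + X]mxE.
by rewrite uv subrr ltxx.
Qed.

End Bilinear.

Lemma ecomp_bcomp (R : realType) (n : nat) (M : smooth_manifold R n)
    (T g : M -> 'M[R]_n) (c : chart R n M) (p : M) : around c p ->
  ecomp c T p *m bcomp c g p = bcomp c (fun p => T p *m g p) p.
Proof.
by move=> cp; rewrite /ecomp /bcomp !mulmxA -(mulmxA (_ *m T p))
  transition_mx_atl// mulmx1.
Qed.

(** * A parallel section gives a closed form *)
Section Backward.
Context {R : realType} {n : nat} {M : smooth_manifold R n}.
Implicit Types (c : chart R n M) (p q : M) (X Y Z : M -> 'rV[R]_n).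
Variables (g T : M -> 'M[R]_n).
Variables nabla nablas : (M -> 'rV[R]_n) -> (M -> 'rV[R]_n) -> M -> 'rV[R]_n.
Hypotheses (Hsmat : smat g nabla nablas) (HT : canonical_section g T).
Hypothesis Hpar : forall X Y, smooth_vfield X -> smooth_vfield Y ->
  nablas X (endo_field T Y) = endo_field T (nabla X Y).

Let Om p := T p *m g p.

Lemma smooth_bil_of_endo : smooth_bil Om.
Proof.
have [/smooth_bilP Hg _ _] : riemannian_metric g by case: Hsmat.
have /smooth_endoP sT : smooth_endo T by case: HT.
apply/smooth_bilP => p c cp.
apply: mxsmooth_congr (mxsmoothM (sT _ _ cp) (Hg _ _ cp)).
apply: filterS (near_around cp) => z cz.
by rewrite ecomp_bcomp.
Qed.

Lemma smooth_endo_field Y : smooth_vfield Y -> smooth_vfield (endo_field T Y).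
Proof.
have /smooth_endoP sT : smooth_endo T by case: HT.
move=> /smooth_vfieldP HY; apply/smooth_vfieldP => p c cp.
apply: mxsmooth_congr (mxsmoothM (HY _ _ cp) (sT _ _ cp)).
by apply: filterS (near_around cp) => z cz; rewrite vcomp_endo.
Qed.

Lemma two_form_of_endo : two_form Om.
Proof.
split; first exact: smooth_bil_of_endo.
have [[_ gsym _] _ _ _] := Hsmat; have [_ skT] := HT.
by move=> p u v; rewrite !bil_mul_endo skT gsym.
Qed.

Lemma form_parallel X Y Z : smooth_vfield X -> smooth_vfield Y ->
  smooth_vfield Z -> lie_fun X (bil_field Om Y Z) =
    bil_field Om (nabla X Y) Z + bil_field Om Y (nabla X Z).
Proof.
move=> HX HY HZ; have [[_ gsym _] _ _ [_ dual]] := Hsmat.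
have E V W : bil_field Om V W = bil_field g W (endo_field T V).
  by apply/funext => p; rewrite /bil_field bil_mul_endo gsym.
rewrite !E dual//; last exact: smooth_endo_field.
by rewrite Hpar// addrC.
Qed.

(** Expressing the brackets through the torsion-free connection, d Om becomes
    the alternation of the covariant derivative of Om, all of whose terms
    cancel by skew-symmetry. *)
Lemma closed_form_of_endo : closed_form Om.
Proof.
move=> X Y Z HX HY HZ; have [_ _ tf _] := Hsmat.
have [_ sk] := two_form_of_endo.
rewrite /ext_d !form_parallel// -!tf//; apply/funext => p.
rewrite -[RHS]/(0 : R).
have D V V' W : bil_field Om (V - V') W p =
    bil_field Om V W p - bil_field Om V' W p by rewrite /bil_field -bilBl.
have S V W : bil_field Om V W p = - bil_field Om W V p by exact: sk.
rewrite !fctE !D (S Y (nabla X Z)) (S X (nabla Y Z)) (S X (nabla Z Y)).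
move: (bil_field _ (nabla X Y) Z p) (bil_field _ (nabla Y X) Z p)
  (bil_field _ (nabla X Z) Y p) (bil_field _ (nabla Z X) Y p)
  (bil_field _ (nabla Y Z) X p) (bil_field _ (nabla Z Y) X p) => *.
by ring.
Qed.

End Backward.

(** * The coordinate expression of closedness *)
Section ClosedForm.
Context {R : realType} {n : nat} {M : smooth_manifold R n}.
Implicit Types (c : chart R n M) (p q : M) (X Y Z : M -> 'rV[R]_n).

Local Notation e_ i := (delta_mx 0 i : 'rV[R]_n).

Lemma mxcderiveN k l c u (F : M -> 'M[R]_(k, l)) q : around c q ->
  mxsmooth F q ->
  mxcderive c u (fun z => - F z) q = - mxcderive c u F q.
Proof.
move=> cq HF; have -> : (fun z => - F z) = (fun z => (fun=> -1) z *: F z).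
  by apply/funext => z; rewrite scaleN1r.
by rewrite mxcderiveZ ?cderive_cst ?scale0r ?add0r ?scaleN1r//;
  exact: fsmooth_cst.
Qed.

Variable Om : M -> 'M[R]_n.
Hypotheses (H2 : two_form Om) (Hcl : closed_form Om).

Lemma bcomp_skew c q : (bcomp c Om q)^T = - bcomp c Om q.
Proof.
have [_ sk] := H2.
rewrite /bcomp !trmx_mul trmxK (skew_bilP (sk q)).
by rewrite mulNmx mulmxN mulmxA.
Qed.

Lemma mxcderive_bcomp_skew c u q j k : around c q ->
  mxcderive c u (bcomp c Om) q j k = - mxcderive c u (bcomp c Om) q k j.
Proof.
move=> cq; have [/smooth_bilP sOm _] := H2.
apply: skew_entry; rewrite -mxcderiveT -mxcderiveN//; last exact: sOm.
by congr mxcderive; apply/funext => z; rewrite bcomp_skew.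
Qed.

(** Evaluate d Om on fields with constant components near the point, whose
    brackets vanish there. *)
Lemma closed_cyclic c q i j k : around c q ->
  mxcderive c (e_ i) (bcomp c Om) q j k + mxcderive c (e_ j) (bcomp c Om) q k i
    +
  mxcderive c (e_ k) (bcomp c Om) q i j = 0.
Proof.
move=> cq; have [/smooth_bilP sOm _] := H2.
have [X sX Xi] := extend_vector (e_ i) cq.
have [Y sY Yj] := extend_vector (e_ j) cq.
have [Z sZ Zk] := extend_vector (e_ k) cq.
have br V W u v : smooth_vfield V -> smooth_vfield W ->
    (\forall z \near q, vcomp c V z = u) -> (\forall z \near q,
      vcomp c W z = v) ->
    lie_bracket V W q = 0.
  move=> /smooth_vfieldP sV /smooth_vfieldP sW Vu Wv.
  rewrite -(vcompK (lie_bracket V W) cq) vcomp_bracket;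
    [|done|exact: sV|exact: sW].
  by rewrite (mxcderive_congr _ cq Vu) (mxcderive_congr _ cq Wv) !mxcderive_cst
    subrr mul0mx.
have lf V W W' u a b : (\forall z \near q, vcomp c V z = u) ->
    (\forall z \near q, vcomp c W z = e_ a) ->
    (\forall z \near q, vcomp c W' z = e_ b) ->
    lie_fun V (bil_field Om W W') q = mxcderive c u (bcomp c Om) q a b.
  move=> Vu Wa Wb.
  have E : \forall z \near q, bcomp c Om z a b = bil_field Om W W' z.
    apply: filterS3 (near_around cq) Wa Wb => z cz wa wb.
    rewrite /bil_field (bil_bcomp _ _ _ cz) wa wb.
    exact/esym/(bil_entry (bcomp c Om z)).
  have sE := fsmooth_congr E (sOm _ _ cq a b).
  rewrite (lie_funE V cq sE) -(cderive_congr _ cq E) (nbhs_singleton Vu).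
  by rewrite mxE.
have := congr1 (fun f => f q) (Hcl sX sY sZ).
rewrite /ext_d !fctE /= (lf _ _ _ _ _ _ Xi Yj Zk) (lf _ _ _ _ _ _ Yj Xi Zk).
rewrite (lf _ _ _ _ _ _ Zk Xi Yj) /bil_field.
rewrite (br _ _ _ _ sX sY Xi Yj) (br _ _ _ _ sX sZ Xi Zk) (br _ _ _ _ sY sZ Yj
  Zk).
have b0 v : bil (Om q) 0 v = 0 by rewrite /bil !mul0mx mxE.
rewrite !b0 !subr0 addr0 (mxcderive_bcomp_skew (e_ j) i k cq) opprK.
by [].
Qed.

End ClosedForm.

(** * A closed form gives a parallel section *)
Section Forward.
Context {R : realType} {d : nat}.
Local Notation n := (2 * d).+1.
Context {M : smooth_manifold R n}.
Implicit Types (c : chart R n M) (p q : M) (X Y Z : M -> 'rV[R]_n).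

Local Notation e_ i := (delta_mx 0 i : 'rV[R]_n).

Lemma mxrank_bcomp c (B : M -> 'M[R]_n) p : around c p ->
  \rank (bcomp c B p) = \rank (B p).
Proof.
move=> cp; have Ju := transition_mx_unit cp (around_chart_at p).
rewrite /bcomp mxrankMfree; last by rewrite row_free_unit unitmx_tr.
by rewrite (eqmxMfull (B p))// row_full_unit.
Qed.

Lemma mxsmooth_christoffel c (W : M -> 'M[R]_n) (e0 : 'rV[R]_n) i q :
  around c q ->
  mxsmooth W q -> bordered (W q) e0 \in unitmx ->
  mxsmooth (fun z => christoffel (W z) e0 (fun j => mxcderive c (e_ j) W z) i)
    q.
Proof.
move=> cq sW Nu.
have sN : mxsmooth (fun z => invmx (bordered (W z) e0)) q.
  by apply: mxsmooth_inv => //; exact: mxsmoothD sW (mxsmooth_cst _ _).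
(* [contorsion] is a polynomial in the entries of [W], of its derivatives and of
   the kernel vector. *)
have sk j : fsmooth (fun z => kernel_vector (W z) e0 0 j) q.
  exact: (mxsmoothM (mxsmooth_cst e0 q) sN) 0 j.
have sA x j k : fsmooth (fun z => mxcderive c (e_ x) W z j k) q.
  exact: (mxsmooth_mxcderive (e_ x) cq sW) j k.
have sdef j k : fsmooth (fun z => defect (W z) e0 (fun j => mxcderive c (e_ j)
  W z) j k) q.
  apply: fsmoothM (fsmooth_cst _ _) _; apply: fsmooth_sum => l _.
  exact: fsmoothM (fsmoothD (sA _ _ _) (sA _ _ _)) (sk l).
have sdef1 j : fsmooth (fun z => defect1 (W z) e0 (fun j => mxcderive c (e_ j)
  W z) j) q.
  by apply: fsmooth_sum => k _; exact: fsmoothM (sdef _ _) (sk k).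
apply: mxsmoothM sN => j k.
apply: (@fsmooth_congr _ _ _
  (fun z => contorsion (W z) e0 (fun j => mxcderive c (e_ j) W z) i j k)).
  by apply: filterE => z; rewrite mxE.
apply: fsmoothB; first apply: fsmoothD.
- exact: fsmoothM (fsmooth_cst _ _) (fsmoothD (sA _ _ _) (sA _ _ _)).
- by apply: fsmoothD; [apply: fsmoothD|]; apply:
    fsmoothM (fsmooth_cst _ _) (sdef _ _).
- by apply: fsmoothD; [apply: fsmoothD|]; apply:
    fsmoothM (fsmooth_cst _ _) (sdef1 _).
Qed.

Variable Om : M -> 'M[R]_n.
Hypothesis HOm : hamiltonian_structure Om.

Let H2 : two_form Om. Proof. by case: HOm. Qed.

Let sOm c q : around c q -> mxsmooth (bcomp c Om) q.
Proof. by have [/smooth_bilP H _] := H2; exact: H. Qed.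

Lemma hamiltonian_rank p : \rank (Om p) = (2 * d)%N.
Proof.
have [[_ sk] _ Hw] := HOm.
by apply/(wedge_pow_rank (skew_bilP (sk p))); exact: Hw.
Qed.

Let W p := bcomp (chart_at p) Om.

Lemma kernel_covector_exists : exists e0 : M -> 'rV[R]_n,
  forall p, bordered (W p p) (e0 p) \in unitmx.
Proof.
suff /choice[e0 He0] : forall p, exists e0, bordered (W p p) e0 \in unitmx.
  by exists e0.
move=> p; apply: bordered_unit => //; first exact: bcomp_skew.
by rewrite mxrank_bcomp ?hamiltonian_rank//; exact: around_chart_at.
Qed.

Section Pieces.
Variable e0 : M -> 'rV[R]_n.
Hypothesis e0P : forall p, bordered (W p p) (e0 p) \in unitmx.

(** The neighbourhood of [p] on which the kernel of the form has the smooth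
    local description by [e0 p]. *)
Definition piece p q := around (chart_at p) q /\ bordered (W p q) (e0 p) \in
  unitmx.

Lemma near_piece p : \forall q \near p, piece p q.
Proof.
have ap := around_chart_at p.
have sb : mxsmooth (fun q => bordered (W p q) (e0 p)) p.
  exact: mxsmoothD (sOm ap) (mxsmooth_cst _ _).
by apply: filterS2 (near_around ap) (near_unitmx (e0P p) sb).
Qed.

Definition local_christoffel p q : 'I_n -> 'M[R]_n :=
  christoffel (W p q) (e0 p) (fun j => mxcderive (chart_at p) (e_ j) (W p) q).

Lemma local_christoffel_smooth p q : piece p q ->
  forall i, mxsmooth (local_christoffel p ^~ i) q.
Proof. by move=> [aq Nu] i; apply: mxsmooth_christoffel => //; exact: sOm. Qed.

Lemma local_christoffel_sym p q : piece p q ->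
  forall i j, row j (local_christoffel p q i) = row i (local_christoffel p q j).
Proof. by move=> _ i j; exact: christoffelC. Qed.

Lemma local_christoffel_parallel p q : piece p q -> forall i,
  mxcderive (chart_at p) (e_ i) (bcomp (chart_at p) Om) q =
  local_christoffel p q i *m bcomp (chart_at p) Om q +
  bcomp (chart_at p) Om q *m (local_christoffel p q i)^T.
Proof.
move=> [aq Nu] i; have [_ Hcl _] := HOm.
apply: (@christoffelP _ _ (W p q) (e0 p) _ _ _
  (fun j => mxcderive (chart_at p) (e_ j) (W p) q)) => //.
- exact: bcomp_skew.
- by rewrite mxrank_bcomp// hamiltonian_rank.
- by move=> x j k; exact: mxcderive_bcomp_skew.
- by move=> x j k; exact: closed_cyclic.
Qed.

(** The Euclidean metric of the chart chosen at [p]. *)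
Definition chart_metric p q : 'M[R]_n :=
  transition_mx (chart_at q) (chart_at p) q *m (transition_mx (chart_at q)
    (chart_at p) q)^T.

Lemma bcomp_chart_metric c p q : around c q -> around (chart_at p) q ->
  bcomp c (chart_metric p) q = transition_mx c (chart_at p) q *m (transition_mx
    c (chart_at p) q)^T.
Proof.
move=> cq pq; have aq := around_chart_at q.
by rewrite /bcomp /chart_metric -(transition_mx_cocycle cq aq pq) trmx_mul
  !mulmxA.
Qed.

Lemma bil_chart_metric p q v : around (chart_at p) q -> v != 0 ->
  0 < bil (chart_metric p q) v v.
Proof.
move=> pq v0; have Ju := transition_mx_unit (around_chart_at q) pq.
rewrite /bil /chart_metric mulmxA -mulmxA -trmx_mul.
set w := v *m _; rewrite lt_def rV_sqr_ge0 andbT.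
apply/negP => /eqP w0; have : w = 0.
  by apply: rV_sqr_eq0; apply/matrixP => i j; rewrite !ord1 w0 mxE.
move=> /(congr1 (mulmx^~ (invmx (transition_mx (chart_at q) (chart_at p) q)))).
by rewrite mulmxK// mul0mx; exact/eqP.
Qed.

Variables (P : nat -> M) (chi : nat -> M -> R) (N : M -> nat).
Hypotheses (chi_sm : forall i q, fsmooth (chi i) q) (chi_ge0 :
  forall i q, 0 <= chi i q)
  (chi_supp : forall i q, (\forall z \near q, chi i z = 0) \/ piece (P i) q)
  (chi_sum : forall q, \forall z \near q,
     (forall i, (N q <= i)%N -> chi i z = 0) /\ \sum_(i < N q) chi i z = 1).

Definition metric : M -> 'M[R]_n := glue chi N (fun i => chart_metric (P i)).

Lemma metricP : riemannian_metric metric.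
Proof.
have bilE p u v : bil (metric p) u v =
    \sum_(i < N p) chi i p * bil (chart_metric (P i) p) u v.
  rewrite /bil /metric /glue mulmx_sumr mulmx_suml summxE.
  by apply: eq_bigr => i _; rewrite -scalemxAr -scalemxAl [LHS]mxE.
split.
- apply/smooth_bilP => q c cq.
  apply: (mxsmooth_glue chi_sm chi_supp chi_sum
    (F := fun i => bcomp c (chart_metric (P i)))).
    by apply: filterE => z; rewrite bcomp_glue.
  move=> i [iq _]; have sJ := mxsmooth_transition cq iq.
  apply: mxsmooth_congr (mxsmoothM sJ (mxsmoothT sJ)).
  by apply: filterS2 (near_around cq) (near_around iq) => z cz iz;
    rewrite bcomp_chart_metric.
- move=> p u v; rewrite !bilE; apply: eq_bigr => i _; congr (_ * _).
  by rewrite bil_tr /chart_metric trmx_mul trmxK.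
- move=> p v v0.
  have term_ge0 i : 0 <= chi i p * bil (chart_metric (P i) p) v v.
    have [[ip _]|/(chi_eq0 chi_supp) ->] := pselect (piece (P i) p).
      by rewrite mulr_ge0// ltW// bil_chart_metric.
    by rewrite mul0r.
  rewrite bilE lt_def sumr_ge0 ?andbT//; apply/negP.
  rewrite psumr_eq0// => /allP H.
  have := sum_chi chi_sum p; rewrite big1 => [/eqP|i _];
    first by rewrite eq_sym oner_eq0.
  have [[ip _]|/(chi_eq0 chi_supp)//] := pselect (piece (P i) p).
  have := H i (mem_index_enum _); rewrite mulf_eq0 => /orP[/eqP//|].
  by rewrite gt_eqF// bil_chart_metric.
Qed.

(** The solution of the Leibniz rule for the metric with respect to the second
    connection. *)
Definition dual_christoffel p q i : 'M[R]_n :=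
  (invmx (bcomp (chart_at p) metric q) *m
   (mxcderive (chart_at p) (e_ i) (bcomp (chart_at p) metric) q -
    local_christoffel p q i *m bcomp (chart_at p) metric q))^T.

Lemma bcomp_metric_unit c q : around c q -> bcomp c metric q \in unitmx.
Proof.
move=> cq; have [_ _ pg] := metricP.
have Ju := transition_mx_unit cq (around_chart_at q).
by rewrite /bcomp !unitmx_mul unitmx_tr Ju (posdef_unit (pg q)).
Qed.

Lemma dual_christoffel_smooth p q : piece p q ->
  forall i, mxsmooth (dual_christoffel p ^~ i) q.
Proof.
move=> pq i; have [aq _] := pq; have [/smooth_bilP sg _ _] := metricP.
have sG := sg _ _ aq; apply: mxsmoothT; apply: mxsmoothM.
  exact: mxsmooth_inv (bcomp_metric_unit aq) sG.
by apply: mxsmoothB; [exact: mxsmooth_mxcderive|apply: mxsmoothM => //;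
  exact: local_christoffel_smooth].
Qed.

Lemma dual_christoffelP p q : piece p q -> forall i,
  mxcderive (chart_at p) (e_ i) (bcomp (chart_at p) metric) q =
  local_christoffel p q i *m bcomp (chart_at p) metric q +
  bcomp (chart_at p) metric q *m (dual_christoffel p q i)^T.
Proof.
move=> [aq _] i; rewrite /dual_christoffel trmxK mulKVmx;
  last exact: bcomp_metric_unit.
by rewrite addrC subrK.
Qed.

Definition glued_nabla : (M -> 'rV[R]_n) -> (M -> 'rV[R]_n) -> M -> 'rV[R]_n :=
  glued_connection P chi N local_christoffel.

Definition glued_dual_nabla : (M -> 'rV[R]_n) -> (M -> 'rV[R]_n) -> M ->
  'rV[R]_n :=
  glued_connection P chi N dual_christoffel.

Let piece_around p q : piece p q -> around (chart_at p) q.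
Proof. by case. Qed.

Lemma smat_glued : smat metric glued_nabla glued_dual_nabla.
Proof.
split; first exact: metricP.
- exact: (connection_glued chi_sm chi_supp chi_sum piece_around
    local_christoffel_smooth).
- exact: (torsion_free_glued chi_supp chi_sum piece_around
    local_christoffel_sym).
- split.
    exact: (connection_glued chi_sm chi_supp chi_sum piece_around
      dual_christoffel_smooth).
  move=> X Y Z HX HY HZ; have [sg _ _] := metricP.
  exact: (dual_glued chi_supp chi_sum piece_around X sg HY HZ
    dual_christoffelP).
Qed.

Definition form_endo p : 'M[R]_n := Om p *m invmx (metric p).

Let metric_unit p : metric p \in unitmx.
Proof. by have [_ _ pg] := metricP; exact: posdef_unit (pg p). Qed.

Lemma form_endoE p u v : bil (metric p) (u *m form_endo p) v = bil (Om p) u v.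
Proof. by rewrite -bil_mul_endo /form_endo mulmxKV. Qed.

Lemma form_endo_canonical : canonical_section metric form_endo.
Proof.
have [sg gsym _] := metricP; have [_ sk] := H2; split.
  apply/smooth_endoP => p c cp; move/smooth_bilP : sg => sg.
  apply: mxsmooth_congr (mxsmoothM (sOm cp) (mxsmooth_inv (bcomp_metric_unit
    cp) (sg _ _ cp))).
  apply: filterS (near_around cp) => z cz.
  rewrite -[RHS](mulmxK (bcomp_metric_unit cz)) ecomp_bcomp//.
  congr (_ *m _); congr bcomp; apply/funext => w.
  by rewrite /form_endo mulmxKV.
by move=> p u v; rewrite form_endoE sk -form_endoE gsym.
Qed.

Lemma form_endo_rank p : \rank (form_endo p) = (2 * d)%N.
Proof.
by rewrite /form_endo mxrankMfree ?hamiltonian_rank// row_free_unit unitmx_inv.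
Qed.

(** Pair both sides with an arbitrary field [Z]: by duality the left side is
    determined by the derivative of Om(Y, Z) along [X], which the parallelism of
    Om turns into the pairing of the right side. *)
Lemma form_endo_parallel X Y : smooth_vfield X -> smooth_vfield Y ->
  glued_dual_nabla X (endo_field form_endo Y) = endo_field form_endo
    (glued_nabla X Y).
Proof.
move=> HX HY; have [_ gsym pg] := metricP; have [_ _ _ [_ dual]] := smat_glued.
apply/funext => q; apply: (posdef_inj (pg q)) => w.
have [Z HZ /nbhs_singleton Zw] := extend_vector w (around_chart_at q).
rewrite vcomp_at in Zw.
have HTY := smooth_endo_field form_endo_canonical HY.
have [sOmega _] := H2.
have E V : bil_field metric V (endo_field form_endo Y) = bil_field Om Y V.
  by apply/funext => p; rewrite /bil_field gsym form_endoE.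
have := dual X Z _ HX HZ HTY; rewrite !E.
have -> : lie_fun X (bil_field Om Y Z) =
    bil_field Om (glued_nabla X Y) Z + bil_field Om Y (glued_nabla X Z).
  exact: (dual_glued chi_supp chi_sum piece_around X sOmega HY HZ
    local_christoffel_parallel).
move=> /(congr1 (fun f => f q)); rewrite !fctE [LHS]addrC => /addrI.
by rewrite /bil_field Zw => HE; rewrite /endo_field [RHS]gsym form_endoE -HE.
Qed.

End Pieces.

Lemma hamiltonian_parallel_section (p0 : M) :
  exists (g : M -> 'M[R]_n) nabla nablas (T : M -> 'M[R]_n),
    smat g nabla nablas /\
    [/\ canonical_section g T, forall p : M, \rank (T p) = (2 * d)%N &
      forall X Y, smooth_vfield X -> smooth_vfield Y ->
        nablas X (endo_field T Y) = endo_field T (nabla X Y)].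
Proof.
have [e0 e0P] := kernel_covector_exists.
have [P [chi [N [chi_sm chi_ge0 chi_supp chi_sum]]]] :=
  partition_of_unity p0 (near_piece e0P).
exists (metric P chi N), (glued_nabla e0 P chi N),
  (glued_dual_nabla e0 P chi N), (form_endo P chi N).
split; first exact: smat_glued.
split; [exact: form_endo_canonical|exact: form_endo_rank|exact:
  form_endo_parallel].
Qed.

End Forward.

(** * The equivalence *)
Lemma parallel_section_hamiltonian (R : realType) (d : nat)
    (M : smooth_manifold R (2 * d).+1) (g T : M -> 'M[R]_((2 * d).+1))
    (nabla nablas : (M -> 'rV[R]_((2 * d).+1)) ->
      (M -> 'rV[R]_((2 * d).+1)) -> M -> 'rV[R]_((2 * d).+1)) :
  smat g nabla nablas -> canonical_section g T ->
  (forall p : M, \rank (T p) = (2 * d)%N) ->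
  (forall X Y, smooth_vfield X -> smooth_vfield Y ->
     nablas X (endo_field T Y) = endo_field T (nabla X Y)) ->
  hamiltonian_structure (fun p => T p *m g p).
Proof.
move=> Hs HT rT Hpar; have two := two_form_of_endo Hs HT.
split=> //; first exact: closed_form_of_endo Hs HT Hpar.
move=> p; have [_ sk] := two.
apply/(wedge_pow_rank (skew_bilP (sk p))).
have [[_ _ pg] _ _ _] := Hs.
by rewrite mxrankMfree ?rT// row_free_unit (posdef_unit (pg p)).
Qed.

(** A partition of unity indexed by the natural numbers requires a point, so the
    empty manifold is treated apart; on it any two fields coincide. *)
Lemma empty_parallel_section (R : realType) (d : nat)
    (M : smooth_manifold R (2 * d).+1) : (M -> False) ->
  exists (g : M -> 'M[R]_((2 * d).+1)) nabla nablas (T : M ->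
    'M[R]_((2 * d).+1)),
    smat g nabla nablas /\
    [/\ canonical_section g T, forall p : M, \rank (T p) = (2 * d)%N &
      forall X Y, smooth_vfield X -> smooth_vfield Y ->
        nablas X (endo_field T Y) = endo_field T (nabla X Y)].
Proof.
move=> M0.
have eqM (V : Type) (F G : M -> V) : F = G by apply/funext => p; case: (M0 p).
have conn : connection (fun _ _ : M -> 'rV[R]_((2 * d).+1) => 0).
  by split=> *; [apply/smooth_vfieldP => p; case: (M0 p)|exact: eqM..].
exists (fun=> 0), (fun _ _ => 0), (fun _ _ => 0), (fun=> 0); split.
  split=> //.
  - by split=> [|p|p]; [apply/smooth_bilP => p|..]; case: (M0 p).
  - by move=> *; exact: eqM.
split.
- by split=> [|p]; [apply/smooth_endoP => p|]; case: (M0 p).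
- by move=> p; case: (M0 p).
- by move=> *; exact: eqM.
Qed.

Theorem theorem1p1 (R : realType) (d : nat) (M : smooth_manifold R (2 * d).+1) :
  ((exists Om : M -> 'M[R]_((2 * d).+1), hamiltonian_structure Om) <->
   (exists (g : M -> 'M[R]_((2 * d).+1))
      (nabla nablas : (M -> 'rV[R]_((2 * d).+1)) ->
         (M -> 'rV[R]_((2 * d).+1)) -> (M -> 'rV[R]_((2 * d).+1)))
      (T : M -> 'M[R]_((2 * d).+1)),
      smat g nabla nablas /\ maximal_parallel_section g nabla nablas T))
  /\
  ((exists Om : M -> 'M[R]_((2 * d).+1), hamiltonian_structure Om) <->
   (exists (g : M -> 'M[R]_((2 * d).+1))
      (nabla nablas : (M -> 'rV[R]_((2 * d).+1)) ->
         (M -> 'rV[R]_((2 * d).+1)) -> (M -> 'rV[R]_((2 * d).+1)))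
      (T : M -> 'M[R]_((2 * d).+1)),
      smat g nabla nablas /\
      [/\ canonical_section g T,
          forall p : M, \rank (T p) = (2 * d)%N &
          forall X Y, smooth_vfield X -> smooth_vfield Y ->
            nablas X (endo_field T Y) = endo_field T (nabla X Y)])).
Proof.
have fwd (Om : M -> 'M[R]_((2 * d).+1)) : hamiltonian_structure Om ->
    exists (g : M -> 'M[R]_((2 * d).+1)) nabla nablas
      (T : M -> 'M[R]_((2 * d).+1)),
      smat g nabla nablas /\
      [/\ canonical_section g T, forall p : M, \rank (T p) = (2 * d)%N &
        forall X Y, smooth_vfield X -> smooth_vfield Y ->
          nablas X (endo_field T Y) = endo_field T (nabla X Y)].
  move=> HOm; have [[p0 _]|M0] := pselect (exists p : M, True).
    exact: hamiltonian_parallel_section HOm p0.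
  by apply: empty_parallel_section => p; apply: M0; exists p.
split; split.
- move=> [Om /fwd[g [nabla [nablas [T [Hs [HT rT Hp]]]]]]].
  exists g, nabla, nablas, T; split=> //; split=> // X Y HX HY.
  by rewrite /endo_connection Hp// subrr.
- move=> [g [nabla [nablas [T [Hs [HT Hp rT]]]]]].
  exists (fun p => T p *m g p).
  apply: parallel_section_hamiltonian Hs HT rT _ => X Y HX HY.
  by apply/eqP; rewrite -subr_eq0; apply/eqP; exact: Hp.
- by move=> [Om /fwd].
- move=> [g [nabla [nablas [T [Hs [HT rT Hp]]]]]].
  exists (fun p => T p *m g p).
  exact: parallel_section_hamiltonian Hs HT rT Hp.
Qed.
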